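(* Let $1<r<3+2\sqrt2$ be real, put $\rho=1/\sqrt r$, and for $z=\rho e^{i\theta}$, $\theta\in[-\pi,\pi]$, let $f(\rho e^{i\theta})=r\,\mathrm{Log}(1+\rho e^{i\theta})+\mathrm{Log}(1-\rho e^{i\theta})-\log\rho-i\theta$ (principal branches). For real $\lambda>0$ let $I(\lambda)=\int_{-\pi}^{\pi}\exp\big(\lambda f(\rho e^{i\theta})\big)\frac{d\theta}{2\pi}$. Define $\gamma_1=\arccos\frac{3r-1}{2\sqrt2 r}$, $\gamma_2=-\arccos\frac{r-3}{2\sqrt2}$ and $\gamma_3=\frac12\arcsin\frac{(r-1)^2}{4r}$. If $\lambda\ge \frac{512r^{3/2}}{(r+1)(-r^2+6r-1)^{3/2}}$, then $$\left\vert \frac{(-r^2+6r-1)^{1/4}\sqrt{\pi\lambda}}{2^{1+\frac{(r+1)\lambda}{2}}}I(\lambda)-\cos\big((r\gamma_1+\gamma_2)\lambda+\gamma_3\big)\right\vert\le \frac{16336}{\sqrt\lambda\,(-r^2+6r-1)^{11/4}}.$$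
   Context: $\mathrm{Log}$ is the principal branch of the complex logarithm; $\arccos,\arcsin$ take their principal values. *)

(* Defs.v *)
From Stdlib Require Import Reals Lra.
From Coquelicot Require Import Coquelicot.
Open Scope R_scope.

Definition Cexp (z : C) : C :=
  (exp (Re z) * cos (Im z), exp (Re z) * sin (Im z)).

(* Principal argument, with values in (-PI, PI]; meaningful only for z <> 0. *)
Definition Carg (z : C) : R :=
  if Rle_dec 0 (Im z) then acos (Re z / Cmod z) else - acos (Re z / Cmod z).

Definition CLog (z : C) : C := (ln (Cmod z), Carg z).

(* [CLog] is characterised, away from 0, as the inverse of [Cexp] with
   imaginary part in (-PI, PI]. *)
Lemma CLog_spec (z : C) :
  z <> 0%C -> Cexp (CLog z) = z /\ - PI < Im (CLog z) <= PI.
Proof.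
intros Hz.
assert (Hm : 0 < Cmod z) by now apply Cmod_gt_0.
assert (Hq : Cmod z * Cmod z = Re z * Re z + Im z * Im z).
{ unfold Cmod, Re, Im. rewrite sqrt_sqrt; [ring | nra]. }
destruct z as [x y]; cbn [Re Im fst snd] in Hq.
set (m := Cmod (x, y)) in *.
assert (Hc2 : (x / m) * (x / m) + (y / m) * (y / m) = 1).
{ replace (_ + _) with ((x * x + y * y) / (m * m)) by (field; lra).
  rewrite <- Hq. field. lra. }
assert (Hc : -1 <= x / m <= 1) by nra.
assert (Hs : sqrt (1 - (x / m)²) = Rabs y / m).
{ replace (1 - (x / m)²) with ((y / m)²) by (unfold Rsqr; lra).
  rewrite sqrt_Rsqr_abs. unfold Rdiv. rewrite Rabs_mult.
  rewrite (Rabs_pos_eq (/ m)); [reflexivity|].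
  left; now apply Rinv_0_lt_compat. }
pose proof (acos_bound (x / m)) as Hb.
unfold Cexp, CLog, Carg; cbn [Re Im fst snd]; fold m.
rewrite exp_ln by exact Hm.
destruct (Rle_dec 0 y) as [Hy | Hy].
- split; [| pose proof PI_RGT_0; lra].
  rewrite cos_acos, sin_acos, Hs, Rabs_pos_eq by lra.
  f_equal; field; lra.
- split.
  + rewrite cos_neg, sin_neg, cos_acos, sin_acos, Hs, Rabs_left by lra.
    f_equal; field; lra.
  + split; [| lra].
    destruct (Rle_lt_or_eq_dec _ _ (proj2 Hb)) as [Hlt | Heq]; [lra|].
    exfalso. assert (E : sin (acos (x / m)) = 0) by (rewrite Heq; apply sin_PI).
    rewrite sin_acos, Hs, Rabs_left in E by lra.
    assert (0 < - y / m) by (apply Rdiv_lt_0_compat; lra). lra.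
Qed.

Definition rho (r : R) : R := 1 / sqrt r.

Definition zpt (r theta : R) : C := (RtoC (rho r) * Cexp (Ci * RtoC theta))%C.

(* A function of theta rather than of z: the two ends theta = -PI, PI of the
   contour give the same z but different values. *)
Definition f (r theta : R) : C :=
  (RtoC r * CLog (1 + zpt r theta) + CLog (1 - zpt r theta)
   - RtoC (ln (rho r)) - Ci * RtoC theta)%C.

(* For 1 < r the circle |z| = rho r < 1 avoids the branch cuts, so the integrand
   is continuous and [RInt] is its genuine complex-valued integral. *)
Definition Iint (r lambda : R) : C :=
  RInt (V := C_R_CompleteNormedModule)
    (fun theta : R => (Cexp (RtoC lambda * f r theta) / RtoC (2 * PI))%C)
    (- PI) PI.

Definition gamma1 (r : R) : R := acos ((3 * r - 1) / (2 * sqrt 2 * r)).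
Definition gamma2 (r : R) : R := - acos ((r - 3) / (2 * sqrt 2)).
Definition gamma3 (r : R) : R := 1 / 2 * asin ((r - 1) ^ 2 / (4 * r)).

(* Main.v *)
(** The saddle points of [f], the roots of [r z^2 - (r-1) z + 1], lie on the
    circle [|z| = rho]; by conjugation only the upper one, at the angle [theta0],
    matters.  Along the circle [Re f <= Re f(theta0) - kappa (t - theta0)^2] on the
    whole of [[0, PI]], and Taylor's formula compares the integrand with the
    complex Gaussian [exp (lambda (f(theta0) + f''(theta0) (t - theta0)^2 / 2))]
    up to [lambda k |t - theta0|^3 exp (- lambda kappa (t - theta0)^2)].  The
    integral of this bound over the line is [k / (lambda kappa^2)], one factor
    [lambda^(-1/2)] smaller than the Gaussian integral.  The lower bound on
    [lambda] makes the same quantity dominate the Gaussian outside [[0, PI]], so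
    no separate tail estimate is needed.  The complex Gaussian integral is
    reduced to the real one by rotating the contour. *)

Require Import Defs.
From Stdlib Require Import Reals Lra Psatz.
From Coquelicot Require Import Coquelicot.
Open Scope R_scope.

(** * Gaussian integrals *)

(** The mean value theorem fails for complex-valued functions, yet the Taylor remainder of [f] must
    be bounded in modulus. The estimates are therefore made on [Re (exp (i b) z) = Re z cos b - Im z
    sin b] for an arbitrary fixed real [b]: this is a real function, and uniformity in [b] recovers
    the modulus. A second obstacle is [r] near 1: the singularities 1 and -1 of the logarithms
    approach the circle, and no cubic remainder constant valid on all of [0, PI] stays bounded. The
    final constant arises as follows. With [kappa = disc / (16 (r+1))], the error
    [k / (lambda kappa^2)] times the normalising factor [disc^(1/4) sqrt lambda / (2 sqrt PI)]
    equals [128 k (r+1)^2 disc / sqrt PI] times [disc^(-11/4) / sqrt lambda]. So the target is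
    [k (r+1)^2 disc <= 220], and [128 * 220 / 1.73 < 16336]. *)

Lemma RInt_ext_R (g h : R -> R) (a b : R) :
  (forall x, Rmin a b < x < Rmax a b -> g x = h x) -> RInt g a b = RInt h a b.
Proof. exact (RInt_ext (V := R_CompleteNormedModule) g h a b). Qed.

Lemma is_derive_RInt_param_all (g dg : R -> R -> R) (a b x : R) :
  (forall u t : R, is_derive (fun v => g v t) u (dg u t)) ->
  (forall u t : R, continuity_2d_pt dg u t) ->
  (forall u t : R, continuous (g u) t) ->
  is_derive (fun u => RInt (g u) a b) x (RInt (dg x) a b).
Proof.
intros Hd Hc Hg.
replace (RInt (dg x) a b) with (RInt (fun t => Derive (fun u => g u t) x) a b).
2:{ apply RInt_ext_R. intros t _. now apply is_derive_unique. }
apply (is_derive_RInt_param g).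
- apply filter_forall. intros u t _. eexists; apply Hd.
- intros t _. apply continuity_2d_pt_ext with (2 := Hc x t).
  intros u v. symmetry. now apply is_derive_unique.
- apply filter_forall. intros u. apply (ex_RInt_continuous (V := R_CompleteNormedModule)).
  intros; apply Hg.
Qed.

Ltac continuity_2d :=
  repeat first
    [ apply continuity_2d_pt_mult | apply continuity_2d_pt_plus
    | apply continuity_2d_pt_minus | apply continuity_2d_pt_opp
    | apply continuity_2d_pt_const | apply continuity_2d_pt_id1
    | apply continuity_2d_pt_id2
    | apply (continuity_1d_2d_pt_comp exp)
    | apply (continuity_1d_2d_pt_comp cos)
    | apply (continuity_1d_2d_pt_comp sin)
    | apply derivable_continuous_pt, derivable_pt_exp
    | apply continuity_cos | apply continuity_sin ].

Lemma mean_value (h dh : R -> R) (a b : R) :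
  (forall x, Rmin a b <= x <= Rmax a b -> is_derive h x (dh x)) ->
  exists c, Rmin a b <= c <= Rmax a b /\ h b - h a = dh c * (b - a).
Proof.
intros H. apply MVT_gen.
- intros x Hx. apply H. lra.
- intros x Hx. apply continuity_pt_filterlim.
  apply (ex_derive_continuous (V := R_NormedModule)). eexists; now apply H.
Qed.

Ltac ctn := apply (ex_derive_continuous (V := R_NormedModule)); auto_derive; auto.
Ltac exint := apply (ex_RInt_continuous (V := R_CompleteNormedModule)); intros; ctn.

Lemma RInt_comp_affine (h : R -> R) (u v a b : R) :
  (forall t, continuous h t) ->
  RInt (fun y => u * h (u * y + v)) a b = RInt h (u * a + v) (u * b + v).
Proof.
intros H. apply (RInt_comp_lin (V := R_CompleteNormedModule) h u v a b).
apply (ex_RInt_continuous (V := R_CompleteNormedModule)); intros; apply H.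
Qed.

Lemma RInt_scal_l (h : R -> R) (a b k : R) :
  ex_RInt h a b -> RInt (fun t => k * h t) a b = k * RInt h a b.
Proof. exact (RInt_scal (V := R_CompleteNormedModule) h a b k). Qed.

(* The sum is constant in [x]; its value is taken at [x = 0]. *)
Lemma gauss_square (x : R) :
  (RInt (fun t => exp (- (t * t))) 0 x) ^ 2
  + RInt (fun s => exp (- (x * x * (1 + s * s))) * / (1 + s * s)) 0 1 = PI / 4.
Proof.
set (G := fun x : R => RInt (fun t => exp (- (t * t))) 0 x).
set (K := fun x : R => RInt (fun s => exp (- (x * x * (1 + s * s))) * / (1 + s * s)) 0 1).
assert (HG : forall y, is_derive G y (exp (- (y * y)))).
{ intros y. apply (is_derive_RInt (fun t => exp (- (t * t))) G 0).
  - apply filter_forall. intros b. apply (RInt_correct (V := R_CompleteNormedModule)). exint.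
  - ctn. }
assert (HK : forall y, is_derive K y (- 2 * exp (- (y * y)) * G y)).
{ intros y.
  replace (- 2 * exp (- (y * y)) * G y)
    with (RInt (fun s => - 2 * y * exp (- (y * y * (1 + s * s)))) 0 1).
  - apply (is_derive_RInt_param_all
      (fun x s => exp (- (x * x * (1 + s * s))) * / (1 + s * s))
      (fun x s => - 2 * x * exp (- (x * x * (1 + s * s))))).
    + intros u t. auto_derive; [nra|]. field. nra.
    + intros u t. continuity_2d.
    + intros u t. ctn. nra.
  (* The substitution [t = y s] brings [G y] to the fixed interval [0, 1], where it matches the
     derivative of [K]. *)
  - assert (E : RInt (fun s => y * exp (- ((y * s + 0) * (y * s + 0)))) 0 1 = G y).
    { rewrite (RInt_comp_affine (fun t => exp (- (t * t)))) by (intros; ctn).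
      unfold G. f_equal; ring. }
    rewrite <- E, <- RInt_scal_l by exint.
    apply RInt_ext_R. intros s _.
    replace (- (y * y * (1 + s * s))) with (- (y * y) + - ((y * s + 0) * (y * s + 0))) by ring.
    rewrite exp_plus. ring. }
fold (G x) (K x).
assert (H0 : G 0 ^ 2 + K 0 = PI / 4).
{ unfold G, K. rewrite RInt_point.
  rewrite (RInt_ext_R _ (fun s => / (1 + s * s))).
  2:{ intros s _. replace (- (0 * 0 * (1 + s * s))) with 0 by ring. rewrite exp_0. ring. }
  rewrite (is_RInt_unique _ _ _ (minus (atan 1) (atan 0))).
  - unfold zero; simpl. rewrite atan_1, atan_0. unfold minus, plus, opp; simpl. field.
  - apply (is_RInt_derive (V := R_CompleteNormedModule) atan).
    + intros s _. apply is_derive_Reals. replace (s * s) with (s ^ 2) by ring.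
      apply derivable_pt_lim_atan.
    + intros s _. ctn. nra. }
rewrite <- H0.
destruct (mean_value (fun y => G y ^ 2 + K y) (fun _ => 0) 0 x) as [c [_ Hc]].
- intros y _. assert (H1 := HG y). assert (H2 := HK y).
  auto_derive; [repeat split; eexists; eassumption|].
  assert (D1 : Derive (fun x : R => G x) y = exp (- (y * y))) by exact (is_derive_unique _ _ _ H1).
  assert (D2 : Derive (fun x : R => K x) y = - 2 * exp (- (y * y)) * G y)
    by exact (is_derive_unique _ _ _ H2).
  rewrite D1, D2.
  simpl. ring.
- simpl in Hc |- *. lra.
Qed.

Lemma sqrt_PI_bounds : 173 / 100 <= sqrt PI <= 2.
Proof.
pose proof PI2_3_2. pose proof PI_4. split.
- apply Rsqr_incr_0_var; [|apply sqrt_pos]. rewrite Rsqr_sqrt; unfold Rsqr; lra.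
- apply Rsqr_incr_0_var; [|lra]. rewrite Rsqr_sqrt; unfold Rsqr; lra.
Qed.

(** [gauss_square] reads [(G - sqrt PI / 2) (G + sqrt PI / 2) = - K] with [0 <= K <= exp (- x^2)],
    and the second factor exceeds 1/2. *)
Lemma gauss_tail (x : R) : 0 <= x ->
  Rabs (RInt (fun t => exp (- (t * t))) 0 x - sqrt PI / 2) <= 2 * exp (- (x * x)).
Proof.
intros Hx.
pose proof (gauss_square x) as H.
set (G := RInt _ 0 x) in *. set (K := RInt _ 0 1) in H.
assert (HG : 0 <= G).
{ apply RInt_ge_0; [exact Hx | exint |]. intros; left; apply exp_pos. }
assert (HK : 0 <= K <= exp (- (x * x))).
{ split.
  - apply RInt_ge_0; [lra | exint; nra |]. intros s _.
    apply Rmult_le_pos; [left; apply exp_pos|]. left; apply Rinv_0_lt_compat; nra.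
  - replace (exp (- (x * x))) with (RInt (fun _ => exp (- (x * x))) 0 1).
    2:{ rewrite RInt_const. unfold scal; simpl; unfold mult; simpl; ring. }
    apply RInt_le; [lra | exint; nra | exint |]. intros s _.
    rewrite <- (Rmult_1_r (exp (- (x * x)))).
    apply Rmult_le_compat.
    + left; apply exp_pos.
    + left; apply Rinv_0_lt_compat; nra.
    + destruct (Req_dec x 0) as [->|]; [right; f_equal; ring|].
      destruct (Req_dec (x * x * (s * s)) 0) as [E|E].
      * right; f_equal; lra.
      * left; apply exp_increasing. nra.
    + rewrite <- Rinv_1. apply Rinv_le_contravar; nra. }
pose proof sqrt_PI_bounds. pose proof (sqrt_sqrt PI (Rlt_le _ _ PI_RGT_0)).
assert ((G - sqrt PI / 2) * (G + sqrt PI / 2) = - K) by nra.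
apply Rabs_le. nra.
Qed.

(* With ph(b) = psi + (al - b) / 2 + A sin b t^2, the b-derivative of
   exp (- A cos b t^2) cos ph is the t-derivative of t / 2 exp (- A cos b t^2) sin ph,
   so the integral changes only by a boundary term while b runs from 0 to al. *)
Lemma rotated_gauss (A al psi X : R) :
  0 <= A -> 0 <= al <= PI / 2 -> 0 <= X ->
  Rabs (RInt (fun t => exp (- (A * cos al * (t * t))) * cos (psi + A * sin al * (t * t))) 0 X
        - cos (psi + al / 2) * RInt (fun t => exp (- (A * (t * t)))) 0 X)
  <= al / 2 * X * exp (- (A * cos al * (X * X))).
Proof.
intros HA Hal HX.
(* At [b = al] this is the phase of the given integral; at [b = 0] it is the constant
   [psi + al / 2], and the real Gaussian remains. *)
set (ph := fun b t => psi + (al - b) / 2 + A * sin b * (t * t)).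
set (g := fun b t => exp (- (A * cos b * (t * t))) * cos (ph b t)).
set (dg := fun b t => exp (- (A * cos b * (t * t)))
   * (A * sin b * (t * t) * cos (ph b t) - sin (ph b t) * (- 1 / 2 + A * cos b * (t * t)))).
set (H := fun b t => t / 2 * exp (- (A * cos b * (t * t))) * sin (ph b t)).
assert (E : forall b, RInt (dg b) 0 X = H b X).
{ intros b. apply is_RInt_unique.
  replace (H b X) with (minus (H b X) (H b 0)).
  2:{ unfold minus, plus, opp, H; simpl; lra. }
  apply (is_RInt_derive (V := R_CompleteNormedModule) (H b) (dg b)).
  - intros t _. unfold H, dg, ph. auto_derive; [auto|]. field.
  - intros t _. unfold dg, ph. ctn. }
destruct (mean_value (fun b => RInt (g b) 0 X) (fun b => H b X) 0 al) as [c [Hc Hm]].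
{ intros b _. rewrite <- E. apply is_derive_RInt_param_all.
  - intros u t. unfold g, dg, ph. auto_derive; [auto|]. unfold Rminus, Rdiv. field.
  - intros u t. unfold dg, ph. unfold Rdiv. continuity_2d.
  - intros u t. unfold g, ph. ctn. }
rewrite Rmin_left, Rmax_right in Hc by lra.
assert (E1 : RInt (g al) 0 X
  = RInt (fun t => exp (- (A * cos al * (t * t))) * cos (psi + A * sin al * (t * t))) 0 X).
{ apply RInt_ext_R. intros t _. unfold g, ph. do 2 f_equal. lra. }
assert (E0 : RInt (g 0) 0 X = cos (psi + al / 2) * RInt (fun t => exp (- (A * (t * t)))) 0 X).
{ rewrite <- RInt_scal_l by exint.
  apply RInt_ext_R. intros t _. unfold g, ph. rewrite cos_0, sin_0.
  replace (A * 1 * (t * t)) with (A * (t * t)) by ring.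
  replace (psi + (al - 0) / 2 + A * 0 * (t * t)) with (psi + al / 2) by field.
  ring. }
rewrite <- E1, <- E0, Hm. unfold H.
assert (C : cos al <= cos c) by (apply cos_decr_1; lra).
unfold Rdiv at 1. rewrite !Rabs_mult, (Rabs_pos_eq X), (Rabs_pos_eq (exp _)), (Rabs_pos_eq (al - 0));
  [| lra | left; apply exp_pos | lra].
rewrite (Rabs_pos_eq (/ 2)) by lra.
assert (S : Rabs (sin (ph c X)) <= 1) by (apply Rabs_le, SIN_bound).
assert (exp (- (A * cos c * (X * X))) <= exp (- (A * cos al * (X * X)))).
{ destruct (Rle_lt_or_eq_dec (A * cos al * (X * X)) (A * cos c * (X * X))) as [L|L].
  - apply Rmult_le_compat_r; [nra|]. apply Rmult_le_compat_l; lra.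
  - left; apply exp_increasing; lra.
  - right; now rewrite L. }
pose proof (exp_pos (- (A * cos c * (X * X)))).
pose proof (Rabs_pos (sin (ph c X))).
assert (exp (- (A * cos c * (X * X))) * Rabs (sin (ph c X)) <= exp (- (A * cos al * (X * X)))) by nra.
assert (0 <= X * al) by nra. nra.
Qed.

Lemma RInt_reflect (h : R -> R) (X : R) :
  (forall t, continuous h t) -> RInt h (- X) 0 = RInt (fun t => h (- t)) 0 X.
Proof.
intros Hc.
pose proof (RInt_comp_affine h (- 1) 0 X 0 Hc) as E.
replace (- 1 * X + 0) with (- X) in E by ring.
replace (- 1 * 0 + 0) with 0 in E by ring.
rewrite <- E.
rewrite <- (opp_RInt_swap (V := R_CompleteNormedModule)).
- rewrite RInt_scal_l.
  + rewrite (RInt_ext_R _ (fun t => h (- t))).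
    * unfold opp; simpl. ring.
    * intros t _. f_equal. ring.
  + apply (ex_RInt_continuous (V := R_CompleteNormedModule)). intros z _.
    apply (continuous_comp (fun y => - 1 * y + 0) h); [ctn | apply Hc].
- apply (ex_RInt_continuous (V := R_CompleteNormedModule)). intros z _.
  apply (continuous_scal_r (V := R_NormedModule) (- 1)).
  apply (continuous_comp (fun y => - 1 * y + 0) h); [ctn | apply Hc].
Qed.

Lemma RInt_symmetric (h : R -> R) (X : R) :
  (forall t, continuous h t) ->
  RInt h (- X) X = RInt (fun t => h (- t)) 0 X + RInt h 0 X.
Proof.
intros Hc. rewrite <- RInt_reflect by exact Hc. symmetry.
apply (RInt_Chasles (V := R_CompleteNormedModule));
  apply (ex_RInt_continuous (V := R_CompleteNormedModule)); intros; apply Hc.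
Qed.

Lemma exp_neg_le_inv (y : R) : 0 < y -> exp (- y) <= / y.
Proof.
intros Hy. rewrite exp_Ropp. apply Rinv_le_contravar; [exact Hy|].
pose proof (exp_ineq1 y). lra.
Qed.

(** The boundary term of [rotated_gauss] and the real Gaussian tail both decay faster than [1 / X].
    This crude rate suffices because [X] is later sent to infinity with everything else fixed. The
    strict [al < PI / 2] keeps [cos al] positive. *)
Lemma rotated_gauss_limit (A al psi : R) :
  0 < A -> 0 <= al < PI / 2 ->
  exists K, forall X, 1 <= X ->
  Rabs (RInt (fun t => exp (- (A * cos al * (t * t))) * cos (psi + A * sin al * (t * t))) (- X) X
        - sqrt (PI / A) * cos (psi + al / 2)) <= K / X.
Proof.
intros HA Hal.
assert (Hc : 0 < cos al) by (apply cos_gt_0; lra).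
assert (HsA : 0 < sqrt A) by now apply sqrt_lt_R0.
assert (Hs2 : sqrt A * sqrt A = A) by (apply sqrt_sqrt; lra).
assert (Hp : 0 < A * cos al) by nra.
exists (al / (A * cos al) + 4 / (sqrt A * A)).
intros X HX.
rewrite RInt_symmetric by (intros; ctn).
rewrite (RInt_ext_R (fun t => exp (- (A * cos al * (- t * - t)))
   * cos (psi + A * sin al * (- t * - t)))
  (fun t => exp (- (A * cos al * (t * t))) * cos (psi + A * sin al * (t * t)))).
2:{ intros t _. now replace (- t * - t) with (t * t) by ring. }
assert (H1 := rotated_gauss A al psi X (Rlt_le _ _ HA) ltac:(lra) ltac:(lra)).
set (I := RInt (fun t => _ * cos _) 0 X) in *.
assert (E : RInt (fun t => exp (- (A * (t * t)))) 0 X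
  = / sqrt A * RInt (fun t => exp (- (t * t))) 0 (sqrt A * X)).
{ replace (sqrt A * X) with (sqrt A * X + 0) by ring.
  replace 0 with (sqrt A * 0 + 0) at 2 by ring.
  rewrite <- (RInt_comp_affine (fun t => exp (- (t * t)))) by (intros; ctn).
  rewrite RInt_scal_l by exint.
  rewrite <- Rmult_assoc, Rinv_l, Rmult_1_l by lra.
  apply RInt_ext_R. intros t _. f_equal. rewrite <- Hs2 at 1. ring. }
rewrite E in H1.
assert (H2 := gauss_tail (sqrt A * X) ltac:(nra)).
set (g := RInt _ 0 (sqrt A * X)) in *.
replace (sqrt A * X * (sqrt A * X)) with (A * (X * X)) in H2 by (rewrite <- Hs2 at 1; ring).
assert (E1 := exp_neg_le_inv (A * cos al * (X * X)) ltac:(apply Rmult_lt_0_compat; nra)).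
assert (E2 := exp_neg_le_inv (A * (X * X)) ltac:(apply Rmult_lt_0_compat; nra)).
assert (F1 : al / 2 * X * exp (- (A * cos al * (X * X))) <= al / 2 / (A * cos al) / X).
{ replace (al / 2 / (A * cos al) / X) with (al / 2 * X * / (A * cos al * (X * X))) by (field; lra).
  apply Rmult_le_compat_l; [nra | exact E1]. }
assert (F2 : / sqrt A * (2 * exp (- (A * (X * X)))) <= 2 / (sqrt A * A) / X).
{ replace (2 / (sqrt A * A) / X) with (/ sqrt A * (2 * (/ (A * (X * X)) * X))) by (field; lra).
  apply Rmult_le_compat_l; [left; now apply Rinv_0_lt_compat|].
  pose proof (exp_pos (- (A * (X * X)))). nra. }
rewrite sqrt_div_alt by exact HA.
set (C := cos (psi + al / 2)) in *.
assert (HC : Rabs C <= 1) by (apply Rabs_le, COS_bound).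
(* Error of the rotation plus tail of the real Gaussian. *)
replace (I + I - sqrt PI / sqrt A * C)
  with (2 * (I - C * (/ sqrt A * g)) + 2 * C * (/ sqrt A * (g - sqrt PI / 2))) by (field; lra).
apply Rle_trans with (1 := Rabs_triang _ _).
rewrite !Rabs_mult, (Rabs_pos_eq 2), (Rabs_pos_eq (/ sqrt A)) by
  (try (left; apply Rinv_0_lt_compat); lra).
set (i := / sqrt A) in *.
assert (Hi : 0 < i) by (now apply Rinv_0_lt_compat).
assert (F3 : Rabs C * (i * Rabs (g - sqrt PI / 2)) <= 2 / (sqrt A * A) / X).
{ apply Rle_trans with (2 := F2).
  pose proof (Rabs_pos (g - sqrt PI / 2)).
  apply Rle_trans with (1 * (i * Rabs (g - sqrt PI / 2))).
  - apply Rmult_le_compat_r; [nra | exact HC].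
  - rewrite Rmult_1_l. apply Rmult_le_compat_l; lra. }
replace ((al / (A * cos al) + 4 / (sqrt A * A)) / X)
  with (2 * (al / 2 / (A * cos al) / X) + 2 * (2 / (sqrt A * A) / X)) by (field; lra).
lra.
Qed.

(** An antiderivative of [t^3 exp (- k t^2)] is [- (t^2 / (2 k) + 1 / (2 k^2)) exp (- k t^2)], so
    each half contributes at most [1 / (2 k^2)]. *)
Lemma RInt_cubic_gauss (k X : R) : 0 < k -> 0 <= X ->
  RInt (fun t => Rabs t ^ 3 * exp (- (k * (t * t)))) (- X) X <= / (k * k).
Proof.
intros Hk HX.
rewrite RInt_symmetric.
2:{ intros t. apply (continuous_mult (K := R_AbsRing)).
  - apply (continuous_comp Rabs (fun y => y ^ 3)); [apply continuous_Rabs | ctn].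
  - ctn. }
rewrite (RInt_ext_R (fun t => Rabs t ^ 3 * exp (- (k * (t * t))))
    (fun t => t ^ 3 * exp (- (k * (t * t)))) 0 X).
rewrite (RInt_ext_R (fun t => Rabs (- t) ^ 3 * exp (- (k * (- t * - t))))
    (fun t => t ^ 3 * exp (- (k * (t * t)))) 0 X).
- rewrite (is_RInt_unique _ _ _ (minus
    ((fun t => - (t * t / (2 * k) + / (2 * k * k)) * exp (- (k * (t * t)))) X)
    ((fun t => - (t * t / (2 * k) + / (2 * k * k)) * exp (- (k * (t * t)))) 0))).
  + unfold minus, plus, opp; simpl.
    replace (- (k * (0 * 0))) with 0 by ring. rewrite exp_0.
    assert (0 <= (X * X / (2 * k) + / (2 * k * k)) * exp (- (k * (X * X)))).
    { apply Rmult_le_pos; [|left; apply exp_pos].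
      assert (0 < / (2 * k * k)) by (apply Rinv_0_lt_compat; nra).
      assert (0 <= X * X / (2 * k)) by (apply Rdiv_le_0_compat; nra). lra. }
    replace (/ (k * k)) with (2 * / (2 * k * k)) by (field; lra).
    replace (0 * 0 / (2 * k)) with 0 by (field; lra). lra.
  + apply (is_RInt_derive (V := R_CompleteNormedModule)
     (fun t => - (t * t / (2 * k) + / (2 * k * k)) * exp (- (k * (t * t))))).
    * intros t _. auto_derive; [auto|]. field. lra.
    * intros t _. ctn.
- intros t Ht. rewrite Rmin_left in Ht by lra.
  rewrite Rabs_Ropp, Rabs_pos_eq by lra. do 2 f_equal. ring.
- intros t Ht. rewrite Rmin_left in Ht by lra. now rewrite Rabs_pos_eq by lra.
Qed.

(** Mean value theorem for [Re exp] on the segment from [(u2, v2)] to [(u1, v1)]. The intermediate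
    angle is unknown, which is why [K] must work for every [b]. *)
Lemma exp_cos_diff (u1 v1 u2 v2 m K : R) :
  u1 <= m -> u2 <= m ->
  (forall b, Rabs ((u1 - u2) * cos b - (v1 - v2) * sin b) <= K) ->
  Rabs (exp u1 * cos v1 - exp u2 * cos v2) <= K * exp m.
Proof.
intros H1 H2 HK.
set (u := fun s => u2 + s * (u1 - u2)). set (v := fun s => v2 + s * (v1 - v2)).
destruct (mean_value (fun s => exp (u s) * cos (v s))
  (fun s => exp (u s) * ((u1 - u2) * cos (v s) - (v1 - v2) * sin (v s))) 0 1) as [s [Hs E]].
{ intros s _. unfold u, v. auto_derive; [auto|]. unfold Rminus. ring. }
rewrite Rmin_left, Rmax_right in Hs by lra.
replace (exp u1 * cos v1 - exp u2 * cos v2)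
  with (exp (u 1) * cos (v 1) - exp (u 0) * cos (v 0)).
2:{ unfold u, v. do 2 f_equal; f_equal; ring. }
rewrite E, Rminus_0_r, Rmult_1_r, Rabs_mult, (Rabs_pos_eq (exp _)) by (left; apply exp_pos).
rewrite Rmult_comm. apply Rmult_le_compat.
- apply Rabs_pos.
- left; apply exp_pos.
- apply HK.
- assert (L : u s <= m) by (unfold u; nra).
  destruct L as [L | ->]; [left; now apply exp_increasing | apply Rle_refl].
Qed.

(** * Real and imaginary parts of f *)

(** In the right half-plane the case distinction of the principal argument disappears; [1 + z] and
    [1 - z] stay there because [Cmod z < 1]. *)
Lemma Carg_atan (x y : R) : 0 < x -> Carg (x, y) = atan (y / x).
Proof.
intros Hx. unfold Carg; cbn [Re Im fst snd].
assert (Hm : 0 < Cmod (x, y)).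
{ apply Cmod_gt_0. intros E. injection E. lra. }
assert (Hq : Cmod (x, y) * Cmod (x, y) = x * x + y * y).
{ unfold Cmod; cbn [fst snd]. rewrite sqrt_sqrt; [ring | nra]. }
set (m := Cmod (x, y)) in *.
assert (E : acos (x / m) = atan (Rabs y / x)).
{ rewrite acos_atan by (now apply Rdiv_lt_0_compat). f_equal.
  replace (1 - (x / m)²) with ((y / m)²).
  - rewrite sqrt_Rsqr_abs. unfold Rdiv. rewrite Rabs_mult, (Rabs_pos_eq (/ m)).
    + field; lra.
    + left; now apply Rinv_0_lt_compat.
  - unfold Rsqr. replace (y / m * (y / m)) with ((m * m - x * x) / (m * m))
      by (rewrite Hq at 1; field; lra).
    field; lra. }
rewrite E. destruct (Rle_dec 0 y).
- now rewrite Rabs_pos_eq.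
- rewrite Rabs_left, <- atan_opp by lra. f_equal. field; lra.
Qed.

Lemma ln_sqrt_half (x : R) : 0 < x -> ln (sqrt x) = / 2 * ln x.
Proof.
intros Hx. assert (0 < sqrt x) by now apply sqrt_lt_R0.
replace (ln x) with (ln (sqrt x * sqrt x)) by (f_equal; apply sqrt_sqrt; lra).
rewrite ln_mult by assumption. field.
Qed.

(** The arguments of the two logarithms are [|1 + z|^2] and [|1 - z|^2]; the last term is
    [- ln (rho r)]. *)
Definition U (r t : R) : R :=
  r / 2 * ln (1 + / r + 2 * cos t / sqrt r) + / 2 * ln (1 + / r - 2 * cos t / sqrt r)
  + / 2 * ln r.

Definition V (r t : R) : R :=
  r * atan (sin t / (sqrt r + cos t)) - atan (sin t / (sqrt r - cos t)) - t.

Lemma sqrt_gt_1 (r : R) : 1 < r -> 1 < sqrt r /\ sqrt r * sqrt r = r.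
Proof.
intros Hr. split; [rewrite <- sqrt_1; apply sqrt_lt_1; lra | apply sqrt_sqrt; lra].
Qed.

Lemma zpt_eq (r t : R) : zpt r t = (cos t / sqrt r, sin t / sqrt r).
Proof.
unfold zpt, Cexp, Ci, RtoC, Cmult, rho; cbn [Re Im fst snd].
replace (0 * t - 1 * 0) with 0 by ring. replace (0 * 0 + 1 * t) with t by ring.
rewrite exp_0. apply injective_projections; cbn [fst snd]; unfold Rdiv; ring.
Qed.

(** [e] is a sign, so that one statement serves both [1 + z] and [1 - z]. *)
Lemma Cmod_polar_sq (s t : R) (e : R) : 1 < s -> e * e = 1 ->
  Cmod (1 + e * (cos t / s), e * (sin t / s)) = sqrt (1 + / (s * s) + 2 * (e * cos t) / s).
Proof.
intros Hs He. unfold Cmod; cbn [fst snd]. f_equal.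
pose proof (sin2_cos2 t) as H. unfold Rsqr in H.
replace (/ (s * s)) with ((e * e) * (sin t * sin t + cos t * cos t) / (s * s)).
- field; lra.
- rewrite He, H. field; lra.
Qed.

Lemma f_eq (r t : R) : 1 < r -> Defs.f r t = (U r t, V r t).
Proof.
intros Hr. destruct (sqrt_gt_1 r Hr) as [Hs Hss].
pose proof (COS_bound t) as Hc.
assert (Hd : 0 < / sqrt r < 1).
{ split; [apply Rinv_0_lt_compat; lra|]. rewrite <- Rinv_1. apply Rinv_lt_contravar; lra. }
assert (Hp : forall x, -1 <= x <= 1 -> 0 < 1 + / r + 2 * x / sqrt r).
{ intros x Hx. replace (/ r) with (/ sqrt r * / sqrt r) by (rewrite <- Hss at 3; field; lra).
  unfold Rdiv. nra. }
unfold Defs.f. rewrite zpt_eq. unfold CLog.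
replace (1 + (cos t / sqrt r, sin t / sqrt r)%R)%C
  with (1 + 1 * (cos t / sqrt r), 1 * (sin t / sqrt r)).
2:{ unfold Cplus, RtoC; cbn [fst snd]. f_equal; ring. }
replace (1 - (cos t / sqrt r, sin t / sqrt r)%R)%C
  with (1 + -1 * (cos t / sqrt r), -1 * (sin t / sqrt r)).
2:{ unfold Cminus, Copp, Cplus, RtoC; cbn [fst snd]. f_equal; ring. }
rewrite !Cmod_polar_sq by lra.
rewrite !Carg_atan by (unfold Rdiv; nra).
rewrite !ln_sqrt_half by (rewrite ?Hss; apply Hp; lra).
unfold U, V, Cminus, Cplus, Copp, Cmult, RtoC, Ci, rho; cbn [fst snd].
rewrite Hss.
f_equal.
- replace (1 / sqrt r) with (/ sqrt r) by (field; lra).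
  rewrite ln_Rinv, ln_sqrt_half by lra.
  replace (2 * (1 * cos t)) with (2 * cos t) by ring.
  replace (1 + / r - 2 * cos t / sqrt r) with (1 + / r + 2 * (-1 * cos t) / sqrt r)
    by (unfold Rdiv; ring).
  field.
- replace (1 * (sin t / sqrt r) / (1 + 1 * (cos t / sqrt r)))
    with (sin t / (sqrt r + cos t)) by (field; lra).
  replace (-1 * (sin t / sqrt r) / (1 + -1 * (cos t / sqrt r)))
    with (- (sin t / (sqrt r - cos t))) by (field; lra).
  rewrite atan_opp. ring.
Qed.

Lemma UV_arg_pos (r t : R) : 1 < r ->
  0 < 1 + / r + 2 * cos t / sqrt r /\ 0 < 1 + / r - 2 * cos t / sqrt r /\
  0 < sqrt r + cos t /\ 0 < sqrt r - cos t /\ 0 < (r + 1) ^ 2 - 4 * r * cos t ^ 2.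
Proof.
intros Hr. destruct (sqrt_gt_1 r Hr) as [Hs Hss].
pose proof (COS_bound t) as Hc.
set (s := sqrt r) in *. clearbody s. subst r.
assert (0 < s * s + 1 + 2 * cos t * s) by nra.
assert (0 < s * s + 1 - 2 * cos t * s) by nra.
repeat split; try nra.
- replace (1 + / (s * s) + 2 * cos t / s) with ((s * s + 1 + 2 * cos t * s) / (s * s)) by (field; lra).
  apply Rdiv_lt_0_compat; nra.
- replace (1 + / (s * s) - 2 * cos t / s) with ((s * s + 1 - 2 * cos t * s) / (s * s)) by (field; lra).
  apply Rdiv_lt_0_compat; nra.
Qed.

(** The cosine of the saddle angle: the saddle points have real part [(r-1) / (2 r)] and modulus
    [1 / sqrt r]. *)
Definition c0 (r : R) : R := (r - 1) / (2 * sqrt r).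

(** On the circle [r z^2 - (r-1) z + 1 = 2 sqrt r z (cos t - c0 r)], so the derivative of [f] in the
    angle is [2 r (cos t - c0 r) / w] with [w = (r+1) sin t + i (r-1) cos t]. The denominator is
    [|w|^2 = r^2 |1 - z^2|^2]; this lemma gives the real part, [is_derive_V] the imaginary part. *)
Lemma is_derive_U (r t : R) : 1 < r ->
  is_derive (U r) t
    ((cos t - c0 r) * (2 * r * ((r + 1) * sin t)) / ((r + 1) ^ 2 - 4 * r * cos t ^ 2)).
Proof.
intros Hr. destruct (sqrt_gt_1 r Hr) as [Hs Hss].
destruct (UV_arg_pos r t Hr) as (H1 & H2 & _ & _ & H3).
unfold U, c0. auto_derive; [tauto|].
set (s := sqrt r) in *. clearbody s. subst r.
assert (0 < s * s + 1 + 2 * cos t * s) by nra.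
assert (0 < s * s + 1 - 2 * cos t * s) by nra.
field. repeat split; nra.
Qed.

Lemma is_derive_V (r t : R) : 1 < r ->
  is_derive (V r) t
    (- ((cos t - c0 r) * (2 * r * ((r - 1) * cos t)) / ((r + 1) ^ 2 - 4 * r * cos t ^ 2))).
Proof.
intros Hr. destruct (sqrt_gt_1 r Hr) as [Hs Hss].
destruct (UV_arg_pos r t Hr) as (_ & _ & H1 & H2 & H3).
pose proof (sin2_cos2 t) as Hsc. unfold Rsqr in Hsc.
unfold V, c0. auto_derive; [repeat split; lra|].
set (s := sqrt r) in *. clearbody s. subst r.
assert (0 < s * s + 1 + 2 * cos t * s) by nra.
assert (0 < s * s + 1 - 2 * cos t * s) by nra.
set (c := cos t) in *. set (n := sin t) in *.
assert (E1 : 1 + n / (s + c) * (n / (s + c) * 1) = (s * s + 1 + 2 * c * s) / ((s + c) * (s + c))).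
{ replace (1 + n / (s + c) * (n / (s + c) * 1)) with (((s + c) * (s + c) + n * n) / ((s + c) * (s + c)))
   by (field; lra). f_equal. nra. }
assert (E2 : 1 + n / (s - c) * (n / (s - c) * 1) = (s * s + 1 - 2 * c * s) / ((s - c) * (s - c))).
{ replace (1 + n / (s - c) * (n / (s - c) * 1)) with (((s - c) * (s - c) + n * n) / ((s - c) * (s - c)))
   by (field; lra). f_equal. nra. }
assert (F1 : 1 * c * / (s + c) + n * (- (1 * - n) * / ((s + c) * (s + c)))
  = (1 + c * s) / ((s + c) * (s + c))).
{ replace (1 + c * s) with (c * (s + c) + n * n) by lra. field; lra. }
assert (F2 : 1 * c * / (s - c) + n * (- - (1 * - n) * / ((s - c) * (s - c)))
  = (c * s - 1) / ((s - c) * (s - c))).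
{ replace (c * s - 1) with (c * (s - c) - n * n) by lra. field; lra. }
change (s + - c) with (s - c).
change (n * / (s + c)) with (n / (s + c)). change (n * / (s - c)) with (n / (s - c)).
rewrite E1, E2, F1, F2.
field. repeat split; nra.
Qed.

(** * Decay away from the saddle *)

(** The left side has derivative [- y (r+1) / ((r+y) (1-y))], and [(r+y) (1-y) <= ((r+1)/2)^2] since
    the two factors have sum [r+1]. Hence the difference of the two sides decreases away from 0 in
    both directions. *)
Lemma ln_saddle_bound (r x : R) : 0 < r -> - r < x < 1 ->
  r * ln (1 + x / r) + ln (1 - x) <= - (2 / (r + 1) * x ^ 2).
Proof.
intros Hr Hx.
assert (Hp : forall y, - r < y -> 0 < 1 + y / r).
{ intros y Hy. replace (1 + y / r) with ((r + y) / r) by (field; lra).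
  apply Rdiv_lt_0_compat; lra. }
destruct (mean_value (fun y => r * ln (1 + y / r) + ln (1 - y) + 2 / (r + 1) * y ^ 2)
  (fun y => y * (4 / (r + 1) - (r + 1) / ((r + y) * (1 - y)))) 0 x) as [y [Hy E]].
{ intros y Hy.
  assert (- r < y < 1) by (revert Hy; unfold Rmin, Rmax; destruct (Rle_dec 0 x); lra).
  auto_derive; [split; [apply Hp; lra | split; [lra | auto]]|].
  field. repeat split; lra. }
simpl in E. replace (1 + 0 / r) with 1 in E by (field; lra).
replace (1 - 0) with 1 in E by ring. rewrite ln_1 in E.
assert (Hy' : - r < y < 1 /\ 0 <= y * x)
  by (revert Hy; unfold Rmin, Rmax; destruct (Rle_dec 0 x); split; nra).
assert (4 / (r + 1) - (r + 1) / ((r + y) * (1 - y)) <= 0).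
{ assert (0 < (r + y) * (1 - y)) by nra.
  replace (4 / (r + 1) - (r + 1) / ((r + y) * (1 - y)))
    with (- ((r + 1) ^ 2 - 4 * ((r + y) * (1 - y))) / ((r + 1) * ((r + y) * (1 - y))))
    by (field; nra).
  assert (0 <= ((r + 1) ^ 2 - 4 * ((r + y) * (1 - y))) / ((r + 1) * ((r + y) * (1 - y)))).
  { apply Rdiv_le_0_compat; [|nra].
    assert (0 <= (r + 2 * y - 1) ^ 2) by apply pow2_ge_0. nra. }
  unfold Rdiv in *. lra. }
simpl. nra.
Qed.

(** At the saddle [|1 + z|^2 = 2] and [|1 - z|^2 = 2 / r]. In the variable
    [x = sqrt r (cos t - c0 r)] these squared moduli become [2 (1 + x/r)] and [(2/r) (1 - x)], the
    situation of [ln_saddle_bound]. *)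
Lemma U_upper (r t : R) : 1 < r ->
  U r t <= (r + 1) / 2 * ln 2 - r / (r + 1) * (cos t - c0 r) ^ 2.
Proof.
intros Hr. destruct (sqrt_gt_1 r Hr) as [Hs Hss].
pose proof (COS_bound t) as Hc.
set (x := sqrt r * (cos t - c0 r)).
assert (Ex : x = sqrt r * cos t - (r - 1) / 2) by (unfold x, c0; field; lra).
assert (Hx : - r < x < 1).
{ rewrite Ex. assert (0 < (sqrt r - 1) ^ 2) by (apply pow_lt; lra). nra. }
assert (L := ln_saddle_bound r x ltac:(lra) Hx).
assert (E1 : 1 + / r + 2 * cos t / sqrt r = 2 * (1 + x / r)).
{ rewrite Ex. clear - Hs Hss. set (s := sqrt r) in *. clearbody s. subst r. field. lra. }
assert (E2 : 1 + / r - 2 * cos t / sqrt r = 2 * / r * (1 - x)).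
{ rewrite Ex. clear - Hs Hss. set (s := sqrt r) in *. clearbody s. subst r. field. lra. }
assert (0 < 1 + x / r).
{ replace (1 + x / r) with ((r + x) / r) by (field; lra). apply Rdiv_lt_0_compat; lra. }
assert (0 < / r) by (apply Rinv_0_lt_compat; lra).
unfold U. rewrite E1, E2, !ln_mult, ln_Rinv by lra.
replace (r / (r + 1) * (cos t - c0 r) ^ 2) with (/ (r + 1) * x ^ 2).
2:{ unfold x. rewrite Rpow_mult_distr. replace (sqrt r ^ 2) with r by (simpl; lra). field; lra. }
unfold Rdiv in *. lra.
Qed.

(** In half angles this is [x/2 <= tan (x/2)]. It is the endpoint case [v = 0] of [cos_gap_left]. *)
Lemma one_minus_cos_ge (x : R) : 0 <= x <= PI -> x / 2 * sin x <= 1 - cos x.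
Proof.
intros Hx.
assert (H1 : forall y, 0 <= y <= PI -> y * cos y <= sin y).
{ intros y Hy.
  destruct (mean_value (fun y => sin y - y * cos y) (fun y => y * sin y) 0 y) as [z [Hz E]].
  { intros z _. auto_derive; [auto | ring]. }
  rewrite Rmin_left, Rmax_right in Hz by lra. rewrite sin_0 in E.
  assert (0 <= sin z) by (apply sin_ge_0; lra).
  assert (0 <= z * sin z * (y - 0)) by (repeat apply Rmult_le_pos; lra). lra. }
destruct (mean_value (fun y => 1 - cos y - y / 2 * sin y) (fun y => (sin y - y * cos y) / 2) 0 x)
  as [z [Hz E]].
{ intros z _. auto_derive; [auto | field]. }
rewrite Rmin_left, Rmax_right in Hz by lra. rewrite sin_0, cos_0 in E.
specialize (H1 z ltac:(lra)). nra.
Qed.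

(** The difference [k] of the two sides has derivative [sin th / 2 - sin y], positive and then
    negative on [0, th]. Its minimum is therefore at an end, where [k 0 >= 0] and [k th = 0]. *)
Lemma cos_gap_left (v th : R) : 0 <= v <= th -> th <= PI / 2 ->
  sin th / 2 * (th - v) <= cos v - cos th.
Proof.
intros Hv Hth. pose proof PI_RGT_0 as Hpi.
set (k := fun y => cos y - cos th - sin th / 2 * (th - y)).
assert (Hk : forall y, is_derive k y (sin th / 2 - sin y)).
{ intros y. unfold k. auto_derive; [auto | field]. }
enough (0 <= k v) by (unfold k in *; lra).
destruct (Rle_lt_dec (sin th / 2) (sin v)) as [H|H].
- destruct (mean_value k (fun y => sin th / 2 - sin y) v th (fun y _ => Hk y)) as [z [Hz E]].
  rewrite Rmin_left, Rmax_right in Hz by lra.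
  assert (sin v <= sin z) by (apply sin_incr_1; lra).
  assert (k th = 0) by (unfold k; ring). nra.
- destruct (mean_value k (fun y => sin th / 2 - sin y) 0 v (fun y _ => Hk y)) as [z [Hz E]].
  rewrite Rmin_left, Rmax_right in Hz by lra.
  assert (sin z <= sin v) by (apply sin_incr_1; lra).
  assert (0 <= k 0).
  { unfold k. rewrite cos_0. pose proof (one_minus_cos_ge th ltac:(lra)). lra. }
  nra.
Qed.

(** Between [th] and [PI - th] the cosine falls at rate at least [sin th]. Beyond [PI - th] the sine
    is too small for this, and the reflection [t -> PI - t] leads back to [cos_gap_left]; the factor
    1/2 comes from there. *)
Lemma cos_gap (t th : R) : 0 <= t <= PI -> 0 <= th <= PI / 2 ->
  sin th / 2 * Rabs (t - th) <= Rabs (cos t - cos th).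
Proof.
intros Ht Hth. pose proof PI_RGT_0 as Hpi.
assert (Hs : 0 <= sin th) by (apply sin_ge_0; lra).
destruct (Rle_lt_dec t th) as [H|H].
- pose proof (cos_gap_left t th ltac:(lra) ltac:(lra)).
  rewrite Rabs_left1, Rabs_pos_eq by nra. lra.
- rewrite Rabs_pos_eq by lra. rewrite <- Rabs_Ropp.
  apply Rle_trans with (2 := Rle_abs _).
  assert (M : forall y, th <= y <= PI - th -> sin th * (y - th) <= cos th - cos y).
  { intros y Hy.
    destruct (mean_value (fun y => - cos y) sin th y) as [z [Hz E]].
    { intros z _. auto_derive; [auto | ring]. }
    rewrite Rmin_left, Rmax_right in Hz by lra.
    assert (sin th <= sin z).
    { destruct (Rle_lt_dec z (PI / 2)).
      - apply sin_incr_1; lra.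
      - rewrite <- (sin_PI_x z). apply sin_incr_1; lra. }
    nra. }
  destruct (Rle_lt_dec t (PI - th)).
  + pose proof (M t ltac:(lra)). nra.
  + pose proof (M (PI - th) ltac:(lra)) as M1.
    pose proof (cos_gap_left (PI - t) th ltac:(lra) ltac:(lra)) as M2.
    rewrite !Rtrigo_facts.cos_pi_minus in *. nra.
Qed.

(** For both signs [e] the function [K (y - a)^(n+1) - e h y] starts at 0 and does not decrease.
    Each use raises the order of a remainder estimate by one. *)
Lemma power_bound_right (h dh : R -> R) (a t K : R) (n : nat) : a <= t ->
  (forall y, a <= y <= t -> is_derive h y (dh y)) -> h a = 0 ->
  (forall y, a <= y <= t -> Rabs (dh y) <= INR (S n) * K * (y - a) ^ n) ->
  Rabs (h t) <= K * (t - a) ^ (S n).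
Proof.
intros Ht Hd H0 Hb.
assert (M : forall e, Rabs e = 1 -> 0 <= K * (t - a) ^ (S n) - e * h t).
{ intros e He.
  destruct (mean_value (fun y => K * (y - a) ^ (S n) - e * h y)
    (fun y => INR (S n) * K * (y - a) ^ n - e * dh y) a t) as [z [Hz E]].
  - rewrite Rmin_left, Rmax_right by lra. intros y Hy.
    pose proof (Hd y Hy) as D.
    apply (is_derive_minus (V := R_NormedModule)).
    + auto_derive; [auto|]. change (K * (1 * (INR (S n) * (y + - a) ^ n)) = INR (S n) * K * (y - a) ^ n). unfold Rminus. ring.
    + apply is_derive_scal. exact D.
  - rewrite Rmin_left, Rmax_right in Hz by lra.
    rewrite H0, Rminus_diag, (pow_i (S n)) in E by auto with arith.
    specialize (Hb z Hz).
    assert (e * dh z <= Rabs (dh z)).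
    { rewrite <- (Rmult_1_l (Rabs (dh z))), <- He, <- Rabs_mult. apply Rle_abs. }
    nra. }
apply Rabs_le. split.
- specialize (M (- 1)). rewrite Rabs_left in M by lra. specialize (M ltac:(lra)). lra.
- specialize (M 1). rewrite Rabs_R1 in M. specialize (M eq_refl). lra.
Qed.

Lemma power_bound (h dh : R -> R) (a t K : R) (n : nat) :
  (forall y, Rmin a t <= y <= Rmax a t -> is_derive h y (dh y)) -> h a = 0 ->
  (forall y, Rmin a t <= y <= Rmax a t -> Rabs (dh y) <= INR (S n) * K * Rabs (y - a) ^ n) ->
  Rabs (h t) <= K * Rabs (t - a) ^ (S n).
Proof.
intros Hd H0 Hb. destruct (Rle_lt_dec a t) as [H|H].
- rewrite Rmin_left, Rmax_right in Hd, Hb by lra.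
  rewrite (Rabs_pos_eq (t - a)) by lra. apply power_bound_right with dh; auto.
  intros y Hy. rewrite <- (Rabs_pos_eq (y - a)) by lra. now apply Hb.
- rewrite Rmin_right, Rmax_left in Hd, Hb by lra.
  (* Reflection about [a] reduces the left side to the right side. *)
  replace (Rabs (t - a)) with ((2 * a - t) - a) by (rewrite Rabs_left; lra).
  replace (h t) with (h (2 * a - (2 * a - t))) by (f_equal; ring).
  apply (power_bound_right (fun y => h (2 * a - y)) (fun y => - dh (2 * a - y))); [lra | | |].
  + intros y Hy. pose proof (Hd (2 * a - y) ltac:(lra)) as D.
    evar_last.
    * apply (is_derive_comp h (fun y => 2 * a - y)); [exact D|].
      auto_derive; [auto | reflexivity].
    * unfold scal; simpl; unfold mult; simpl. ring.
  + replace (2 * a - a) with a by ring. exact H0.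
  + intros y Hy. rewrite Rabs_Ropp.
    replace (y - a) with (Rabs (2 * a - y - a)) by (rewrite Rabs_left1; lra).
    apply Hb. lra.
Qed.

(** * The saddle point *)

(** Minus the discriminant of [r z^2 - (r-1) z + 1], that is [4 r - (r-1)^2]. *)
Definition disc (r : R) : R := - r ^ 2 + 6 * r - 1.
Definition theta0 (r : R) : R := acos (c0 r).
Definition alpha (r : R) : R := asin ((r - 1) ^ 2 / (4 * r)).

Lemma disc_bounds (r : R) : 1 < r < 3 + 2 * sqrt 2 -> 0 < disc r <= 8 /\ r < 583 / 100.
Proof.
intros Hr.
assert (H2 : sqrt 2 * sqrt 2 = 2) by (apply sqrt_sqrt; lra).
pose proof (sqrt_pos 2).
assert (1414 / 1000 < sqrt 2 < 1415 / 1000) by (split; nra).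
pose proof (pow2_ge_0 (r - 3)).
unfold disc. repeat split; [|lra|lra].
replace (- r ^ 2 + 6 * r - 1) with ((r - (3 - 2 * sqrt 2)) * (3 + 2 * sqrt 2 - r)).
2:{ transitivity (- r ^ 2 + 6 * r - 9 + 4 * (sqrt 2 * sqrt 2)); [ring | rewrite H2; ring]. }
apply Rmult_lt_0_compat; lra.
Qed.

Lemma sin_alpha_bounds (r : R) : 1 < r < 3 + 2 * sqrt 2 -> 0 < (r - 1) ^ 2 / (4 * r) < 1.
Proof.
intros Hr. destruct (disc_bounds r Hr) as [[H1 H2] H3]. unfold disc in *. split.
- apply Rdiv_lt_0_compat; [apply pow_lt|]; lra.
- apply Rmult_lt_reg_r with (4 * r); [lra|]. field_simplify; lra.
Qed.

Lemma c0_bounds (r : R) : 1 < r < 3 + 2 * sqrt 2 -> 0 < c0 r < 1.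
Proof.
intros Hr. destruct (disc_bounds r Hr) as [[H1 H2] H3]. unfold disc in *.
destruct (sqrt_gt_1 r ltac:(lra)) as [Hs Hss].
unfold c0. split; [apply Rdiv_lt_0_compat; lra|].
apply Rmult_lt_reg_r with (2 * sqrt r); [lra|].
replace ((r - 1) / (2 * sqrt r) * (2 * sqrt r)) with (r - 1) by (field; lra).
nra.
Qed.

Lemma sqrt_sq_eq (x y : R) : 0 <= y -> x = y * y -> sqrt x = y.
Proof. intros Hy ->. now apply sqrt_square. Qed.

Lemma theta0_spec (r : R) : 1 < r < 3 + 2 * sqrt 2 ->
  0 < theta0 r < PI / 2 /\ cos (theta0 r) = c0 r /\
  sin (theta0 r) = sqrt (disc r) / (2 * sqrt r).
Proof.
intros Hr. destruct (disc_bounds r Hr) as [[H1 H2] H3].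
destruct (sqrt_gt_1 r ltac:(lra)) as [Hs Hss].
pose proof (c0_bounds r Hr) as Hc.
pose proof (sqrt_sqrt (disc r) ltac:(lra)) as Hd.
pose proof (sqrt_lt_R0 (disc r) ltac:(lra)) as Hd0.
unfold theta0. rewrite cos_acos, sin_acos by lra.
split; [|split; [reflexivity|]].
- split; [apply acos_bound_lt; lra|]. rewrite acos_atan by lra. apply atan_bound.
- apply sqrt_sq_eq; [apply Rdiv_le_0_compat; lra|].
  replace (sqrt (disc r) / (2 * sqrt r) * (sqrt (disc r) / (2 * sqrt r)))
    with (sqrt (disc r) * sqrt (disc r) / (4 * (sqrt r * sqrt r))) by (field; lra).
  rewrite Hd, Hss. unfold Rsqr, c0, disc.
  replace ((r - 1) / (2 * sqrt r) * ((r - 1) / (2 * sqrt r)))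
    with ((r - 1) * (r - 1) / (4 * (sqrt r * sqrt r))) by (field; lra).
  rewrite Hss. field. lra.
Qed.

(** The cosine comes from [(4 r)^2 - (r-1)^4 = (4 r - (r-1)^2) (4 r + (r-1)^2) = disc r (r+1)^2]. *)
Lemma alpha_spec (r : R) : 1 < r < 3 + 2 * sqrt 2 ->
  0 <= alpha r < PI / 2 /\ sin (alpha r) = (r - 1) ^ 2 / (4 * r) /\
  cos (alpha r) = (r + 1) * sqrt (disc r) / (4 * r).
Proof.
intros Hr. destruct (disc_bounds r Hr) as [[H1 H2] H3].
pose proof (sin_alpha_bounds r Hr) as Hs.
pose proof (sqrt_sqrt (disc r) ltac:(lra)) as Hd.
pose proof (sqrt_lt_R0 (disc r) ltac:(lra)) as Hd0.
unfold alpha. rewrite sin_asin, cos_asin by lra.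
split; [|split; [reflexivity|]].
- split; [|apply asin_bound_lt; lra].
  rewrite asin_acos by lra.
  rewrite acos_atan by lra. pose proof (atan_bound (sqrt (1 - ((r - 1) ^ 2 / (4 * r))²) / ((r - 1) ^ 2 / (4 * r)))).
  lra.
- apply sqrt_sq_eq; [apply Rdiv_le_0_compat; nra|].
  replace ((r + 1) * sqrt (disc r) / (4 * r) * ((r + 1) * sqrt (disc r) / (4 * r)))
    with ((r + 1) * (r + 1) * (sqrt (disc r) * sqrt (disc r)) / (16 * (r * r))) by (field; lra).
  rewrite Hd. unfold disc, Rsqr. field. lra.
Qed.

(** With [z0] the upper saddle, [gamma1] is the argument of [1 + z0], because [Re (1 + z0) / sqrt 2]
    is the number under its [acos]. The argument of [1 - z0] is [- a], and it joins with the term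
    [- theta0] to form [gamma2]. *)
Lemma V_saddle (r : R) : 1 < r < 3 + 2 * sqrt 2 ->
  V r (theta0 r) = r * gamma1 r + gamma2 r.
Proof.
intros Hr. destruct (disc_bounds r Hr) as [[H1 H2] H3].
destruct (sqrt_gt_1 r ltac:(lra)) as [Hs Hss].
pose proof (sqrt_sqrt (disc r) ltac:(lra)) as Hd.
pose proof (sqrt_lt_R0 (disc r) ltac:(lra)) as Hd0.
pose proof (sqrt_sqrt 2 ltac:(lra)) as Hq.
pose proof (sqrt_lt_R0 2 ltac:(lra)) as Hq0.
pose proof (c0_bounds r Hr) as Hc.
destruct (theta0_spec r Hr) as (Ht & Hct & Hst).
unfold V. rewrite Hct, Hst.
assert (E1 : atan (sqrt (disc r) / (2 * sqrt r) / (sqrt r + c0 r)) = gamma1 r).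
{ unfold gamma1. rewrite acos_atan by (apply Rdiv_lt_0_compat; nra).
  f_equal.
  rewrite (sqrt_sq_eq (1 - ((3 * r - 1) / (2 * sqrt 2 * r))²) (sqrt (disc r) / (2 * sqrt 2 * r))).
  - unfold c0.
    replace (sqrt r + (r - 1) / (2 * sqrt r)) with ((2 * (sqrt r * sqrt r) + (r - 1)) / (2 * sqrt r))
      by (field; lra).
    rewrite Hss. field. repeat split; lra.
  - apply Rdiv_le_0_compat; nra.
  - replace (sqrt (disc r) / (2 * sqrt 2 * r) * (sqrt (disc r) / (2 * sqrt 2 * r)))
      with (sqrt (disc r) * sqrt (disc r) / (4 * (sqrt 2 * sqrt 2) * (r * r))) by (field; lra).
    unfold Rsqr.
    replace ((3 * r - 1) / (2 * sqrt 2 * r) * ((3 * r - 1) / (2 * sqrt 2 * r)))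
      with ((3 * r - 1) * (3 * r - 1) / (4 * (sqrt 2 * sqrt 2) * (r * r))) by (field; lra).
    rewrite Hd, Hq. unfold disc. field. lra. }
set (a := atan (sqrt (disc r) / (2 * sqrt r) / (sqrt r - c0 r))).
assert (Hy : sqrt (disc r) / (2 * sqrt r) / (sqrt r - c0 r) = sqrt (disc r) / (r + 1)).
{ unfold c0.
  replace (sqrt r - (r - 1) / (2 * sqrt r)) with ((2 * (sqrt r * sqrt r) - (r - 1)) / (2 * sqrt r))
    by (field; lra).
  rewrite Hss. field. repeat split; lra. }
assert (Ea : a = acos ((r + 1) / (2 * sqrt 2 * sqrt r))).
{ unfold a. rewrite Hy, acos_atan by (apply Rdiv_lt_0_compat; nra). f_equal.
  rewrite (sqrt_sq_eq (1 - ((r + 1) / (2 * sqrt 2 * sqrt r))²) (sqrt (disc r) / (2 * sqrt 2 * sqrt r))).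
  - field. repeat split; lra.
  - apply Rdiv_le_0_compat; nra.
  - replace (sqrt (disc r) / (2 * sqrt 2 * sqrt r) * (sqrt (disc r) / (2 * sqrt 2 * sqrt r)))
      with (sqrt (disc r) * sqrt (disc r) / (4 * (sqrt 2 * sqrt 2) * (sqrt r * sqrt r))) by (field; lra).
    unfold Rsqr.
    replace ((r + 1) / (2 * sqrt 2 * sqrt r) * ((r + 1) / (2 * sqrt 2 * sqrt r)))
      with ((r + 1) * (r + 1) / (4 * (sqrt 2 * sqrt 2) * (sqrt r * sqrt r))) by (field; lra).
    rewrite Hd, Hq, Hss. unfold disc. field. lra. }
assert (Hx : -1 <= (r + 1) / (2 * sqrt 2 * sqrt r) <= 1).
{ assert (0 < (r + 1) / (2 * sqrt 2 * sqrt r)) by (apply Rdiv_lt_0_compat; nra).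
  split; [lra|]. apply Rmult_le_reg_r with (2 * sqrt 2 * sqrt r); [nra|].
  replace ((r + 1) / (2 * sqrt 2 * sqrt r) * (2 * sqrt 2 * sqrt r)) with (r + 1) by (field; lra).
  apply Rsqr_incr_0_var; [|nra]. unfold Rsqr.
  replace (1 * (2 * sqrt 2 * sqrt r) * (1 * (2 * sqrt 2 * sqrt r)))
    with (4 * (sqrt 2 * sqrt 2) * (sqrt r * sqrt r)) by ring.
  rewrite Hq, Hss. unfold disc in *. nra. }
assert (Ha : - PI / 2 < a < PI / 2) by apply atan_bound.
assert (Ha0 : 0 <= a) by (rewrite Ea; apply acos_bound).
assert (Esin : sin a = sqrt (disc r) / (2 * sqrt 2 * sqrt r)).
{ rewrite Ea, sin_acos by exact Hx. apply sqrt_sq_eq.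
  - apply Rdiv_le_0_compat; nra.
  - replace (sqrt (disc r) / (2 * sqrt 2 * sqrt r) * (sqrt (disc r) / (2 * sqrt 2 * sqrt r)))
      with (sqrt (disc r) * sqrt (disc r) / (4 * (sqrt 2 * sqrt 2) * (sqrt r * sqrt r))) by (field; lra).
    unfold Rsqr.
    replace ((r + 1) / (2 * sqrt 2 * sqrt r) * ((r + 1) / (2 * sqrt 2 * sqrt r)))
      with ((r + 1) * (r + 1) / (4 * (sqrt 2 * sqrt 2) * (sqrt r * sqrt r))) by (field; lra).
    rewrite Hd, Hq, Hss. unfold disc. field. lra. }
(* The addition formula gives [((r^2 - 1) - disc r) / (4 sqrt 2 r) = (r - 3) / (2 sqrt 2)]; since
   [a + theta0] lies in [0, PI], [acos] undoes the cosine. *)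
assert (E2 : gamma2 r = - (a + theta0 r)).
{ unfold gamma2. f_equal. rewrite <- (acos_cos (a + theta0 r)) by lra. f_equal.
  rewrite cos_plus, Hct, Hst, Esin, Ea, cos_acos by exact Hx. unfold c0.
  replace ((r + 1) / (2 * sqrt 2 * sqrt r) * ((r - 1) / (2 * sqrt r)) -
     sqrt (disc r) / (2 * sqrt 2 * sqrt r) * (sqrt (disc r) / (2 * sqrt r)))
   with (((r + 1) * (r - 1) - sqrt (disc r) * sqrt (disc r)) / (4 * sqrt 2 * (sqrt r * sqrt r)))
   by (field; lra).
  rewrite Hd, Hss. unfold disc. field. split; lra. }
rewrite E1, E2. ring.
Qed.

(** * Taylor remainder of the phase *)

Lemma sin_lipschitz (a t : R) : Rabs (sin t - sin a) <= Rabs (t - a).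
Proof.
pose proof (power_bound (fun y => sin y - sin a) cos a t 1 0) as H.
rewrite pow_1, (Rmult_1_l (Rabs (t - a))) in H. apply H.
- intros y _. auto_derive; [auto | ring].
- ring.
- intros y _. simpl. rewrite !Rmult_1_r. apply Rabs_le, COS_bound.
Qed.

Lemma cos_taylor1 (a t : R) : Rabs (cos t - cos a + sin a * (t - a)) <= / 2 * Rabs (t - a) ^ 2.
Proof.
apply (power_bound (fun y => cos y - cos a + sin a * (y - a)) (fun y => sin a - sin y)).
- intros y _. auto_derive; [auto | ring].
- ring.
- intros y _. rewrite <- Rabs_Ropp, Ropp_minus_distr.
  replace (INR 2 * / 2 * Rabs (y - a) ^ 1) with (Rabs (y - a)) by (simpl; field).
  apply sin_lipschitz.
Qed.

(** The squared chord is [2 - 2 cos (t - a)], at most the squared arc. *)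
Lemma unit_circle_chord (a t : R) :
  (sin t - sin a) ^ 2 + (cos t - cos a) ^ 2 <= (t - a) ^ 2.
Proof.
pose proof (sin2_cos2 t) as H1. pose proof (sin2_cos2 a) as H2. unfold Rsqr in *.
pose proof (cos_taylor1 0 (t - a)) as H. rewrite cos_0, sin_0, Rminus_0_r, pow2_abs in H.
apply Rabs_le_between in H. rewrite cos_minus in H. nra.
Qed.

Lemma rotate_le_Cmod (z : C) (b : R) : Rabs (fst z * cos b - snd z * sin b) <= Cmod z.
Proof.
unfold Cmod. rewrite <- sqrt_Rsqr_abs. apply sqrt_le_1_alt. unfold Rsqr.
pose proof (sin2_cos2 b) as H. unfold Rsqr in H.
replace (fst z ^ 2 + snd z ^ 2) with ((fst z ^ 2 + snd z ^ 2) * (sin b * sin b + cos b * cos b))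
  by (rewrite H; ring).
assert (0 <= (fst z * sin b + snd z * cos b) ^ 2) by apply pow2_ge_0. nra.
Qed.

(* With w = (r+1) sin t + i (r-1) cos t and w0 its value at the saddle,
   f' = (cos t - cos theta0) 2r / w and f'' (theta0) = - sin theta0 2r / w0, hence
   (f' - f''(theta0) (t - theta0)) w
     = 2r (cos t - cos theta0 + sin theta0 (t - theta0))
       + sin theta0 (t - theta0) conj(w0) (w - w0) / 2, because |w0|^2 = 4r. *)
Lemma slope_remainder (r t om b : R) :
  1 < r < 3 + 2 * sqrt 2 -> 0 < om -> om ^ 2 <= (r + 1) ^ 2 - 4 * r * cos t ^ 2 ->
  Rabs (((cos t - c0 r) * (2 * r * ((r + 1) * sin t)) / ((r + 1) ^ 2 - 4 * r * cos t ^ 2)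
          + (r + 1) * disc r / (8 * r) * (t - theta0 r)) * cos b
        - (- ((cos t - c0 r) * (2 * r * ((r - 1) * cos t)) / ((r + 1) ^ 2 - 4 * r * cos t ^ 2))
          - sqrt (disc r) * (r - 1) ^ 2 / (8 * r) * (t - theta0 r)) * sin b)
  <= (r + (r + 1) * sqrt (disc r) / 2) / om * (t - theta0 r) ^ 2.
Proof.
intros Hr Hom HQ. destruct (disc_bounds r Hr) as [[H1 H2] H3].
destruct (sqrt_gt_1 r ltac:(lra)) as [Hs Hss].
pose proof (sqrt_sqrt (disc r) ltac:(lra)) as Hd.
pose proof (sqrt_lt_R0 (disc r) ltac:(lra)) as Hd0.
destruct (theta0_spec r Hr) as (Ht & Hct & Hst).
pose proof (cos_taylor1 (theta0 r) t) as T1. rewrite pow2_abs in T1.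
pose proof (unit_circle_chord (theta0 r) t) as T2.
pose proof (sin2_cos2 t) as Hsc. unfold Rsqr in Hsc.
set (Q := (r + 1) ^ 2 - 4 * r * cos t ^ 2) in *.
assert (HQ0 : 0 < Q) by (assert (0 < om ^ 2) by (now apply pow_lt); lra).
assert (EQ : Q = ((r + 1) * sin t) ^ 2 + ((r - 1) * cos t) ^ 2).
{ unfold Q. replace ((r + 1) ^ 2) with ((r + 1) ^ 2 * (sin t * sin t + cos t * cos t)) by (rewrite Hsc; ring).
  ring. }
rewrite Hct in T1, T2.
assert (Es : disc r = 4 * r * sin (theta0 r) ^ 2).
{ rewrite Hst. replace (4 * r * (sqrt (disc r) / (2 * sqrt r)) ^ 2)
  with (r * (sqrt (disc r) * sqrt (disc r)) / (sqrt r * sqrt r)) by (field; lra).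
  rewrite Hd, Hss. field. lra. }
assert (Ed : sqrt (disc r) = 2 * sqrt r * sin (theta0 r)) by (rewrite Hst; field; lra).
assert (Ec : r - 1 = 2 * sqrt r * c0 r) by (unfold c0; field; lra).
assert (E4 : ((r + 1) * sin (theta0 r)) ^ 2 + ((r - 1) * c0 r) ^ 2 = 4 * r).
{ assert (E : 4 * r * ((r + 1) * sin (theta0 r)) ^ 2 + 4 * r * ((r - 1) * c0 r) ^ 2 = 4 * r * (4 * r)).
  - replace (4 * r * ((r - 1) * c0 r) ^ 2) with ((r - 1) ^ 2 * (2 * sqrt r * c0 r) ^ 2).
    2:{ transitivity (4 * (sqrt r * sqrt r) * ((r - 1) * c0 r) ^ 2); [ring | now rewrite Hss]. }
    rewrite <- Ec. replace (4 * r * ((r + 1) * sin (theta0 r)) ^ 2) with ((r + 1) ^ 2 * disc r)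
      by (rewrite Es; ring). unfold disc. ring.
  - nra. }
set (s0 := sin (theta0 r)) in *. set (x := t - theta0 r) in *.
set (w := ((r + 1) * sin t, (r - 1) * cos t) : C).
set (w0 := ((r + 1) * s0, - ((r - 1) * c0 r)) : C).
set (dw := ((r + 1) * (sin t - s0), (r - 1) * (cos t - c0 r)) : C).
set (z := ((cos t - c0 r) * (2 * r * ((r + 1) * sin t)) / Q + (r + 1) * disc r / (8 * r) * x,
  - ((cos t - c0 r) * (2 * r * ((r - 1) * cos t)) / Q)
  - sqrt (disc r) * (r - 1) ^ 2 / (8 * r) * x) : C).
apply Rle_trans with (1 := rotate_le_Cmod z b).
assert (Ez : (z * w = RtoC (2 * r * (cos t - c0 r + s0 * x)) + RtoC (s0 * x / 2) * w0 * dw)%C).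
{ assert (X1 : (r + 1) * disc r / (8 * r) = (r + 1) * s0 ^ 2 / 2) by (rewrite Es; field; lra).
  assert (X2 : sqrt (disc r) * (r - 1) ^ 2 / (8 * r) = s0 * (r - 1) * c0 r / 2).
  { rewrite Ed. replace ((r - 1) ^ 2) with ((r - 1) * (2 * sqrt r * c0 r)) by (rewrite <- Ec; ring).
    replace (2 * sqrt r * s0 * ((r - 1) * (2 * sqrt r * c0 r)))
     with (4 * (sqrt r * sqrt r) * s0 * (r - 1) * c0 r) by ring.
    rewrite Hss. field. lra. }
  unfold z, w, w0, dw, RtoC, Cmult, Cplus; cbn [fst snd]. rewrite X1, X2.
  apply injective_projections; cbn [fst snd].
  - transitivity (2 * r * (cos t - c0 r) * ((((r + 1) * sin t) ^ 2 + ((r - 1) * cos t) ^ 2) / Q)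
       + s0 * x / 2 * ((r + 1) * s0 * ((r + 1) * sin t) + (r - 1) * c0 r * ((r - 1) * cos t))).
    + field. lra.
    + rewrite <- EQ, Rdiv_diag by lra.
      replace (2 * r * (cos t - c0 r + s0 * x))
       with (2 * r * (cos t - c0 r) + s0 * x / 2 * (4 * r)) by field.
      rewrite <- E4. ring.
  - field. lra. }
assert (Cw : om <= Cmod w).
{ unfold Cmod, w; cbn [fst snd]. rewrite <- EQ. rewrite <- (sqrt_pow2 om) by lra.
  now apply sqrt_le_1_alt. }
assert (Cw0 : Cmod w0 = 2 * sqrt r).
{ unfold Cmod, w0; cbn [fst snd]. apply sqrt_sq_eq; [lra|].
  replace (2 * sqrt r * (2 * sqrt r)) with (4 * (sqrt r * sqrt r)) by ring.
  rewrite Hss, <- E4. ring. }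
assert (Cdw : Cmod dw <= (r + 1) * Rabs x).
{ unfold Cmod, dw; cbn [fst snd].
  replace ((r + 1) * Rabs x) with (sqrt (((r + 1) * Rabs x) ^ 2)).
  - apply sqrt_le_1_alt. rewrite !Rpow_mult_distr, pow2_abs.
    assert (0 <= (cos t - c0 r) ^ 2) by apply pow2_ge_0.
    assert ((r - 1) ^ 2 <= (r + 1) ^ 2) by nra.
    apply Rle_trans with ((r + 1) ^ 2 * ((sin t - s0) ^ 2 + (cos t - c0 r) ^ 2)); [nra|].
    apply Rmult_le_compat_l; [apply pow2_ge_0 | exact T2].
  - apply sqrt_pow2. apply Rmult_le_pos; [lra | apply Rabs_pos]. }
assert (Hs0 : 0 < s0) by (rewrite Hst; apply Rdiv_lt_0_compat; lra).
(* The summand [r] is [2 r] times the 1/2 of [cos_taylor1]; the other is [s0 / 2] times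
   [Cmod w0 = 2 sqrt r] times [r + 1], rewritten with [sqrt (disc r) = 2 sqrt r s0]. *)
assert (B : Cmod z * Cmod w <= (r + (r + 1) * sqrt (disc r) / 2) * x ^ 2).
{ rewrite <- Cmod_mult, Ez. apply Rle_trans with (1 := Cmod_triangle _ _).
  rewrite !Cmod_mult, !Cmod_R, Cw0, !Rabs_mult, (Rabs_pos_eq 2), (Rabs_pos_eq r) by lra.
  unfold Rdiv at 1. rewrite !Rabs_mult, (Rabs_pos_eq s0), (Rabs_pos_eq (/ 2)) by lra.
  assert (Ex : x ^ 2 = Rabs x * Rabs x) by (rewrite <- pow2_abs; ring).
  rewrite Ed. pose proof (Rabs_pos x).
  assert (s0 * Rabs x * / 2 * (2 * sqrt r) * Cmod dw <= s0 * Rabs x * / 2 * (2 * sqrt r) * ((r + 1) * Rabs x)).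
  { apply Rmult_le_compat_l; [|exact Cdw]. repeat apply Rmult_le_pos; lra. }
  assert (2 * r * Rabs (cos t - c0 r + s0 * x) <= 2 * r * (/ 2 * x ^ 2))
    by (apply Rmult_le_compat_l; lra).
  apply Rle_trans with (2 * r * (/ 2 * x ^ 2)
     + s0 * Rabs x * / 2 * (2 * sqrt r) * ((r + 1) * Rabs x)); [lra|].
  rewrite Ex. right. field. }
replace ((r + (r + 1) * sqrt (disc r) / 2) / om * x ^ 2)
  with ((r + (r + 1) * sqrt (disc r) / 2) * x ^ 2 / om) by (field; lra).
apply Rmult_le_reg_r with om; [exact Hom|].
replace ((r + (r + 1) * sqrt (disc r) / 2) * x ^ 2 / om * om)
  with ((r + (r + 1) * sqrt (disc r) / 2) * x ^ 2) by (field; lra).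
apply Rle_trans with (2 := B). apply Rmult_le_compat_l; [apply Cmod_ge_0 | exact Cw].
Qed.

(** Integrates [slope_remainder] from the saddle at fixed [b]: a slope error [3 k x^2] gives an
    error [k |x|^3]. Here [om] is a lower bound for [|w|] along the way. *)
Lemma phase_remainder (r t om k b : R) :
  1 < r < 3 + 2 * sqrt 2 -> 0 < om ->
  (forall y, Rmin (theta0 r) t <= y <= Rmax (theta0 r) t ->
     om ^ 2 <= (r + 1) ^ 2 - 4 * r * cos y ^ 2) ->
  (r + (r + 1) * sqrt (disc r) / 2) / om <= 3 * k ->
  Rabs ((U r t - U r (theta0 r) + (r + 1) * disc r / (16 * r) * (t - theta0 r) ^ 2) * cos b
        - (V r t - V r (theta0 r) - sqrt (disc r) * (r - 1) ^ 2 / (16 * r) * (t - theta0 r) ^ 2) * sin b)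
  <= k * Rabs (t - theta0 r) ^ 3.
Proof.
intros Hr Hom HQ Hk.
apply (power_bound
  (fun t => (U r t - U r (theta0 r) + (r + 1) * disc r / (16 * r) * (t - theta0 r) ^ 2) * cos b
    - (V r t - V r (theta0 r) - sqrt (disc r) * (r - 1) ^ 2 / (16 * r) * (t - theta0 r) ^ 2) * sin b)
  (fun t => ((cos t - c0 r) * (2 * r * ((r + 1) * sin t)) / ((r + 1) ^ 2 - 4 * r * cos t ^ 2)
          + (r + 1) * disc r / (8 * r) * (t - theta0 r)) * cos b
        - (- ((cos t - c0 r) * (2 * r * ((r - 1) * cos t)) / ((r + 1) ^ 2 - 4 * r * cos t ^ 2))
          - sqrt (disc r) * (r - 1) ^ 2 / (8 * r) * (t - theta0 r)) * sin b)).
- intros y _.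
  pose proof (is_derive_U r y ltac:(lra)) as DU. pose proof (is_derive_V r y ltac:(lra)) as DV.
  auto_derive; [repeat split; eexists; eassumption|].
  assert (D1 : Derive (fun x : R => U r x) y = _) by exact (is_derive_unique _ _ _ DU).
  assert (D2 : Derive (fun x : R => V r x) y = _) by exact (is_derive_unique _ _ _ DV).
  rewrite D1, D2. field. pose proof (UV_arg_pos r y ltac:(lra)). lra.
- ring.
- intros y Hy. apply Rle_trans with (1 := slope_remainder r y om b Hr Hom (HQ y Hy)).
  rewrite <- pow2_abs. apply Rmult_le_compat_r; [apply pow2_ge_0|]. simpl. lra.
Qed.

(** * Bounds for the cubic remainder constant *)

Ltac bernstein7 u v :=
  assert (0 <= u ^ 7) by (apply pow_le; lra);
  assert (0 <= v ^ 7) by (apply pow_le; lra);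
  assert (0 <= u ^ 6 * v ^ 1) by (apply Rmult_le_pos; apply pow_le; lra);
  assert (0 <= u ^ 5 * v ^ 2) by (apply Rmult_le_pos; apply pow_le; lra);
  assert (0 <= u ^ 4 * v ^ 3) by (apply Rmult_le_pos; apply pow_le; lra);
  assert (0 <= u ^ 3 * v ^ 4) by (apply Rmult_le_pos; apply pow_le; lra);
  assert (0 <= u ^ 2 * v ^ 5) by (apply Rmult_le_pos; apply pow_le; lra);
  assert (0 <= u ^ 1 * v ^ 6) by (apply Rmult_le_pos; apply pow_le; lra).

(* On each of [3/2, 4] and [4, 5.83] the difference of the two sides has
   nonnegative Bernstein coefficients. *)
Lemma remainder_constant_poly (r : R) : 3 / 2 <= r <= 583 / 100 ->
  (r + (r + 1) * (disc r + 729 / 100) * (5 / 54)) * ((r + 1) ^ 2 * disc r) <= 660 * (r - 1).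
Proof.
intros Hr. unfold disc. destruct (Rle_lt_dec r 4) as [H|H].
- set (u := r - 3 / 2). set (v := 4 - r).
  assert (0 <= u /\ 0 <= v) by (unfold u, v; lra).
  bernstein7 u v. unfold u, v in *. lra.
- set (u := r - 4). set (v := 583 / 100 - r).
  assert (0 <= u /\ 0 <= v) by (unfold u, v; lra).
  bernstein7 u v. unfold u, v in *. lra.
Qed.

(** This [k] belongs to [om = r - 1], the minimum of [|w|] over the whole circle. *)
Lemma remainder_constant_large (r : R) : 3 / 2 <= r < 3 + 2 * sqrt 2 ->
  let k := (r + (r + 1) * sqrt (disc r) / 2) / (3 * (r - 1)) in
  / 3 <= k /\ k * ((r + 1) ^ 2 * disc r) <= 220.
Proof.
intros Hr k. destruct (disc_bounds r ltac:(lra)) as [[H1 H2] H3].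
pose proof (sqrt_sqrt (disc r) ltac:(lra)) as Hd.
pose proof (sqrt_lt_R0 (disc r) ltac:(lra)) as Hd0.
(* A tangent line of the square root, at [disc r = 2.7^2], makes the inequality polynomial in
   [r]. *)
assert (Hd1 : sqrt (disc r) <= (disc r + 729 / 100) * (5 / 27)).
{ assert (0 <= (sqrt (disc r) - 27 / 10) ^ 2) by apply pow2_ge_0. lra. }
assert (Hp := remainder_constant_poly r ltac:(lra)).
unfold k. split.
- apply Rmult_le_reg_r with (3 * (r - 1)); [lra|].
  replace ((r + (r + 1) * sqrt (disc r) / 2) / (3 * (r - 1)) * (3 * (r - 1)))
    with (r + (r + 1) * sqrt (disc r) / 2) by (field; lra).
  nra.
- apply Rmult_le_reg_r with (3 * (r - 1)); [lra|].
  replace ((r + (r + 1) * sqrt (disc r) / 2) / (3 * (r - 1)) * ((r + 1) ^ 2 * disc r) * (3 * (r - 1)))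
    with ((r + (r + 1) * sqrt (disc r) / 2) * ((r + 1) ^ 2 * disc r)) by (field; lra).
  replace (220 * (3 * (r - 1))) with (660 * (r - 1)) by ring.
  apply Rle_trans with (2 := Hp).
  apply Rmult_le_compat_r; [apply Rmult_le_pos; [apply pow2_ge_0 | lra]|].
  assert ((r + 1) * sqrt (disc r) <= (r + 1) * ((disc r + 729 / 100) * (5 / 27)))
    by (apply Rmult_le_compat_l; lra). lra.
Qed.

(** * Pointwise comparison of the integrand with the Gaussian *)

Lemma U_saddle (r : R) : 1 < r < 3 + 2 * sqrt 2 -> U r (theta0 r) = (r + 1) / 2 * ln 2.
Proof.
intros Hr. destruct (sqrt_gt_1 r ltac:(lra)) as [Hs Hss].
destruct (theta0_spec r Hr) as (_ & Hct & _).
unfold U. rewrite Hct. unfold c0.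
replace (2 * ((r - 1) / (2 * sqrt r)) / sqrt r) with ((r - 1) / (sqrt r * sqrt r)) by (field; lra).
rewrite Hss.
replace (1 + / r + (r - 1) / r) with 2 by (field; lra).
replace (1 + / r - (r - 1) / r) with (2 * / r) by (field; lra).
assert (0 < / r) by (apply Rinv_0_lt_compat; lra).
rewrite ln_mult, ln_Rinv by lra. field.
Qed.

(** Equals [r / (r+1) * (sin theta0 / 2)^2]: the coefficient of [U_upper] times the squared slope of
    [cos_gap]. *)
Definition kappa (r : R) : R := disc r / (16 * (r + 1)).

Lemma U_decay (r t : R) : 1 < r < 3 + 2 * sqrt 2 -> 0 <= t <= PI ->
  U r t - U r (theta0 r) <= - (kappa r * (t - theta0 r) ^ 2).
Proof.
intros Hr Ht. rewrite U_saddle by exact Hr.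
pose proof (U_upper r t ltac:(lra)) as HU.
destruct (disc_bounds r Hr) as [[H1 H2] H3].
destruct (sqrt_gt_1 r ltac:(lra)) as [Hs Hss].
destruct (theta0_spec r Hr) as (Hb & Hct & Hst).
pose proof (cos_gap t (theta0 r) Ht ltac:(lra)) as Hg. rewrite Hct in Hg.
assert (Hs0 : 0 < sin (theta0 r)).
{ rewrite Hst. apply Rdiv_lt_0_compat; [apply sqrt_lt_R0|]; lra. }
assert (Hg2 : (sin (theta0 r) / 2 * Rabs (t - theta0 r)) ^ 2 <= Rabs (cos t - c0 r) ^ 2).
{ apply pow_incr. split; [apply Rmult_le_pos; [lra | apply Rabs_pos] | exact Hg]. }
rewrite Rpow_mult_distr, !pow2_abs in Hg2.
assert (E : kappa r = r / (r + 1) * (sin (theta0 r) / 2) ^ 2).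
{ rewrite Hst. unfold kappa.
  replace ((sqrt (disc r) / (2 * sqrt r) / 2) ^ 2)
    with (sqrt (disc r) * sqrt (disc r) / (16 * (sqrt r * sqrt r))) by (field; lra).
  rewrite Hss, sqrt_sqrt by lra. field. lra. }
rewrite E.
assert (0 < r / (r + 1)) by (apply Rdiv_lt_0_compat; lra).
assert (r / (r + 1) * ((sin (theta0 r) / 2) ^ 2 * (t - theta0 r) ^ 2)
   <= r / (r + 1) * (cos t - c0 r) ^ 2) by (apply Rmult_le_compat_l; lra).
lra.
Qed.

(** As [sin theta0 = sqrt (disc r) / (2 sqrt r)], the conclusion says
    [lambda (r+1) sin^3 theta0 >= 64]. *)
Lemma lambda_saddle (r lambda : R) : 1 < r < 3 + 2 * sqrt 2 ->
  512 * Rpower r (3 / 2) / ((r + 1) * Rpower (disc r) (3 / 2)) <= lambda ->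
  512 * sqrt r ^ 3 <= lambda * ((r + 1) * sqrt (disc r) ^ 3).
Proof.
intros Hr. destruct (disc_bounds r Hr) as [[H1 H2] H3].
assert (E : forall x, 0 < x -> Rpower x (3 / 2) = sqrt x ^ 3).
{ intros x Hx. rewrite <- (Rpower_sqrt x) by exact Hx.
  rewrite <- Rpower_pow by apply exp_pos. rewrite Rpower_mult. f_equal. simpl. lra. }
rewrite !E by lra. intros HL.
assert (0 < sqrt (disc r)) by (apply sqrt_lt_R0; lra).
assert (0 < sqrt (disc r) ^ 3) by now apply pow_lt.
apply Rmult_le_compat_r with (r := (r + 1) * sqrt (disc r) ^ 3) in HL; [|nra].
replace (512 * sqrt r ^ 3 / ((r + 1) * sqrt (disc r) ^ 3) * ((r + 1) * sqrt (disc r) ^ 3))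
  with (512 * sqrt r ^ 3) in HL by (field; lra).
exact HL.
Qed.

Lemma exp_le (x y : R) : x <= y -> exp x <= exp y.
Proof. intros [H | ->]; [left; now apply exp_increasing | apply Rle_refl]. Qed.

(* f'' (theta0) = - 2 (pw - i qw), and pw - i qw = sqrt (disc r) / 4 * exp (- i alpha). *)
Definition pw (r : R) : R := (r + 1) * disc r / (16 * r).
Definition qw (r : R) : R := sqrt (disc r) * (r - 1) ^ 2 / (16 * r).

Definition integrand (r lambda t : R) : R :=
  exp (lambda * (U r t - U r (theta0 r))) * cos (lambda * V r t).
Definition gaussian (r lambda x : R) : R :=
  exp (- (lambda * pw r * (x * x))) * cos (lambda * V r (theta0 r) + lambda * qw r * (x * x)).
Definition majorant (r lambda k x : R) : R :=
  lambda * k * (Rabs x ^ 3 * exp (- (lambda * kappa r * (x * x)))).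

Lemma kappa_le_pw (r : R) : 1 < r < 3 + 2 * sqrt 2 -> 0 < kappa r <= pw r.
Proof.
intros Hr. destruct (disc_bounds r Hr) as [[H1 H2] H3]. unfold kappa, pw. split.
- apply Rdiv_lt_0_compat; lra.
- apply Rmult_le_reg_r with (16 * r * (r + 1)); [nra|].
  replace (disc r / (16 * (r + 1)) * (16 * r * (r + 1))) with (disc r * r) by (field; lra).
  replace ((r + 1) * disc r / (16 * r) * (16 * r * (r + 1)))
    with (disc r * ((r + 1) * (r + 1))) by (field; lra).
  apply Rmult_le_compat_l; nra.
Qed.

Lemma gaussian_decay (r lambda x : R) : 1 < r < 3 + 2 * sqrt 2 -> 0 < lambda ->
  Rabs (gaussian r lambda x) <= exp (- (lambda * kappa r * (x * x))).
Proof.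
intros Hr Hl. pose proof (kappa_le_pw r Hr) as Hk. unfold gaussian.
rewrite Rabs_mult, Rabs_pos_eq by (left; apply exp_pos).
rewrite <- (Rmult_1_r (exp (- (lambda * kappa r * (x * x))))).
apply Rmult_le_compat; [left; apply exp_pos | apply Rabs_pos | | apply Rabs_le, COS_bound].
apply exp_le. assert (0 <= x * x) by nra.
assert (lambda * kappa r * (x * x) <= lambda * pw r * (x * x)).
{ apply Rmult_le_compat_r; [assumption|]. apply Rmult_le_compat_l; lra. }
lra.
Qed.

(** Integrand and Gaussian are each at most [exp (- lambda kappa x^2)], hence the threshold 2. *)
Lemma pointwise_trivial (r lambda k t : R) :
  1 < r < 3 + 2 * sqrt 2 -> 0 < lambda -> 0 <= t <= PI ->
  2 <= lambda * k * Rabs (t - theta0 r) ^ 3 ->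
  Rabs (integrand r lambda t - gaussian r lambda (t - theta0 r))
    <= majorant r lambda k (t - theta0 r).
Proof.
intros Hr Hl Ht H2. pose proof (gaussian_decay r lambda (t - theta0 r) Hr Hl) as Hg.
set (x := t - theta0 r) in *. unfold majorant.
set (e := exp (- (lambda * kappa r * (x * x)))) in *.
assert (Hi : Rabs (integrand r lambda t) <= e).
{ unfold integrand. rewrite Rabs_mult, Rabs_pos_eq by (left; apply exp_pos).
  rewrite <- (Rmult_1_r e).
  apply Rmult_le_compat; [left; apply exp_pos | apply Rabs_pos | | apply Rabs_le, COS_bound].
  apply exp_le. pose proof (U_decay r t Hr Ht) as HU. fold x in HU. nra. }
assert (He : 0 < e) by apply exp_pos.
apply Rle_trans with (1 := Rabs_triang _ _). rewrite Rabs_Ropp. nra.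
Qed.

Lemma pointwise_taylor (r lambda om k t : R) :
  1 < r < 3 + 2 * sqrt 2 -> 0 < lambda -> 0 <= t <= PI -> 0 < om ->
  (forall y, Rmin (theta0 r) t <= y <= Rmax (theta0 r) t ->
     om ^ 2 <= (r + 1) ^ 2 - 4 * r * cos y ^ 2) ->
  (r + (r + 1) * sqrt (disc r) / 2) / om <= 3 * k ->
  Rabs (integrand r lambda t - gaussian r lambda (t - theta0 r))
    <= majorant r lambda k (t - theta0 r).
Proof.
intros Hr Hl Ht Hom HQ Hk.
pose proof (fun b => phase_remainder r t om k b Hr Hom HQ Hk) as HP.
pose proof (U_decay r t Hr Ht) as HU. pose proof (kappa_le_pw r Hr) as Hkp.
set (x := t - theta0 r) in *. unfold integrand, gaussian, majorant.
rewrite <- (Rmult_assoc (lambda * k) (Rabs x ^ 3)).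
apply exp_cos_diff.
- nra.
- assert (0 <= x * x) by nra.
  assert (lambda * kappa r * (x * x) <= lambda * pw r * (x * x)).
  { apply Rmult_le_compat_r; [assumption|]. apply Rmult_le_compat_l; lra. }
  lra.
- intros b. specialize (HP b). fold (pw r) (qw r) in HP.
  replace ((lambda * (U r t - U r (theta0 r)) - - (lambda * pw r * (x * x))) * cos b
     - (lambda * V r t - (lambda * V r (theta0 r) + lambda * qw r * (x * x))) * sin b)
   with (lambda * ((U r t - U r (theta0 r) + pw r * x ^ 2) * cos b
       - (V r t - V r (theta0 r) - qw r * x ^ 2) * sin b)) by ring.
  rewrite Rabs_mult, (Rabs_pos_eq lambda), (Rmult_assoc lambda k) by lra.
  apply Rmult_le_compat_l; [lra | exact HP].
Qed.

(* At the ends of [0, PI] the derivatives of f blow up as r tends to 1, so for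
   r < 3/2 Taylor's formula is used only for |t - theta0| < 1/2; elsewhere
   lambda k |t - theta0|^3 >= 2 and the triangle inequality suffices. *)
Lemma pointwise_bound (r lambda : R) : 1 < r < 3 + 2 * sqrt 2 -> 0 < lambda ->
  512 * sqrt r ^ 3 <= lambda * ((r + 1) * sqrt (disc r) ^ 3) ->
  exists k, / 3 <= k /\ k * ((r + 1) ^ 2 * disc r) <= 220 /\
  forall t, 0 <= t <= PI ->
    Rabs (integrand r lambda t - gaussian r lambda (t - theta0 r))
    <= majorant r lambda k (t - theta0 r).
Proof.
intros Hr Hl HL. destruct (disc_bounds r Hr) as [[H1 H2] H3].
destruct (sqrt_gt_1 r ltac:(lra)) as [Hs Hss].
pose proof (sqrt_sqrt (disc r) ltac:(lra)) as Hd.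
pose proof (sqrt_lt_R0 (disc r) ltac:(lra)) as Hd0.
destruct (Rle_lt_dec (3 / 2) r) as [Hr2 | Hr2].
- destruct (remainder_constant_large r ltac:(lra)) as [K1 K2].
  eexists; split; [exact K1 | split; [exact K2 |]].
  intros t Ht. apply pointwise_taylor with (om := r - 1); try assumption; [lra| |].
  + intros y _. pose proof (COS_bound y). assert (cos y ^ 2 <= 1) by nra.
    assert (r * cos y ^ 2 <= r * 1) by (apply Rmult_le_compat_l; lra). lra.
  + right. field. lra.
(* With [om = 9/10] the requirement is [r + (r+1) sqrt (disc r) / 2 <= 3 * 2 * 9/10], true for
   [r < 3/2]; and [2 (r+1)^2 disc r] is at most 100. *)
- exists 2. split; [lra|]. split.
  { assert (0 <= (r + 1) ^ 2 <= 25 / 4) by (split; nra).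
    assert ((r + 1) ^ 2 * disc r <= 25 / 4 * 8) by (apply Rmult_le_compat; lra). lra. }
  assert (Hd1 : sqrt (disc r) <= 283 / 100) by nra.
  intros t Ht. destruct (Rle_lt_dec (/ 2) (Rabs (t - theta0 r))) as [Hx | Hx].
  + apply pointwise_trivial; try assumption.
    (* At distance 1/2 from the saddle, [lambda * 2 * (1/2)^3] reaches 2 exactly when [lambda]
       reaches 8. *)
    assert (8 <= lambda).
    { assert (1 <= sqrt r ^ 3) by (apply pow_R1_Rle; lra).
      assert (sqrt (disc r) ^ 3 <= 283 / 100 * 8).
      { replace (sqrt (disc r) ^ 3) with (sqrt (disc r) * (sqrt (disc r) * sqrt (disc r))) by ring.
        rewrite Hd. apply Rmult_le_compat; lra. }
      assert (0 < sqrt (disc r) ^ 3) by (apply pow_lt; lra).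
      assert ((r + 1) * sqrt (disc r) ^ 3 <= 5 / 2 * (283 / 100 * 8)) by (apply Rmult_le_compat; lra).
      nra. }
    assert ((/ 2) ^ 3 <= Rabs (t - theta0 r) ^ 3) by (apply pow_incr; lra).
    nra.
  (* For [r < 3/2] the sine of the saddle angle is at least 0.95, so within distance 1/2 it is at
     least 0.45, and [|w|^2 >= 4 r sin^2 y >= 0.81]. *)
  + apply pointwise_taylor with (om := 9 / 10); try assumption; [lra| |].
    * intros y Hy.
      destruct (theta0_spec r Hr) as (Hb & Hct & Hst).
      assert (Hs0 : 95 / 100 <= sin (theta0 r)).
      { rewrite Hst. apply Rmult_le_reg_r with (2 * sqrt r); [lra|].
        replace (sqrt (disc r) / (2 * sqrt r) * (2 * sqrt r)) with (sqrt (disc r)) by (field; lra).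
        apply Rsqr_incr_0_var; [|lra]. unfold Rsqr. rewrite Hd.
        replace (95 / 100 * (2 * sqrt r) * (95 / 100 * (2 * sqrt r)))
          with (361 / 100 * (sqrt r * sqrt r)) by field.
        rewrite Hss. unfold disc. nra. }
      assert (Hyx : Rabs (y - theta0 r) <= / 2).
      { apply Rabs_def2 in Hx. apply Rabs_le. revert Hy. unfold Rmin, Rmax.
        destruct (Rle_dec (theta0 r) t); lra. }
      pose proof (sin_lipschitz (theta0 r) y) as HS.
      assert (Hsy : 45 / 100 <= sin y).
      { assert (HS' : Rabs (sin y - sin (theta0 r)) <= / 2) by lra.
        apply Rabs_le_between in HS'. lra. }
      pose proof (sin2_cos2 y) as Hsc. unfold Rsqr in Hsc.
      replace ((r + 1) ^ 2 - 4 * r * cos y ^ 2)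
        with ((r - 1) ^ 2 + 4 * r * (sin y * sin y + cos y * cos y) - 4 * r * cos y ^ 2)
        by (rewrite Hsc; ring).
      assert (0 <= (r - 1) ^ 2) by apply pow2_ge_0. nra.
    * apply Rmult_le_reg_r with (9 / 10); [lra|].
      replace ((r + (r + 1) * sqrt (disc r) / 2) / (9 / 10) * (9 / 10))
        with (r + (r + 1) * sqrt (disc r) / 2) by field.
      assert ((r + 1) * sqrt (disc r) <= 5 / 2 * (283 / 100)) by (apply Rmult_le_compat; lra).
      lra.
Qed.

(** * Laplace's method *)

Lemma continuous_integrand (r lambda t : R) : 1 < r -> continuous (integrand r lambda) t.
Proof.
intros Hr. apply (ex_derive_continuous (V := R_NormedModule)).
pose proof (is_derive_U r t Hr) as DU. pose proof (is_derive_V r t Hr) as DV.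
unfold integrand. auto_derive. repeat split; eexists; eassumption.
Qed.

Lemma continuous_majorant (r lambda k x : R) : continuous (majorant r lambda k) x.
Proof.
apply (continuous_scal_r (V := R_NormedModule) (lambda * k)).
apply (continuous_mult (K := R_AbsRing)).
- apply (continuous_comp Rabs (fun y => y ^ 3)); [apply continuous_Rabs | ctn].
- ctn.
Qed.

(** On [a, b] the majorant pays for the difference, on the two outer pieces for [g] alone; the three
    bounds add up to a single integral of [M]. *)
Lemma RInt_compare (h g M : R -> R) (a b X : R) :
  - X <= a -> a <= b -> b <= X ->
  (forall x, continuous h x) -> (forall x, continuous g x) -> (forall x, continuous M x) ->
  (forall x, a <= x <= b -> Rabs (h x - g x) <= M x) ->
  (forall x, x <= a \/ b <= x -> Rabs (g x) <= M x) ->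
  Rabs (RInt h a b - RInt g (- X) X) <= RInt M (- X) X.
Proof.
intros H1 H2 H3 Ch Cg CM Hin Hout.
assert (I : forall (k : R -> R) u v, (forall x, continuous k x) -> ex_RInt k u v).
{ intros k u v Ck. apply (ex_RInt_continuous (V := R_CompleteNormedModule)). intros; apply Ck. }
assert (S : forall k : R -> R, (forall x, continuous k x) ->
  RInt k (- X) X = RInt k (- X) a + RInt k a b + RInt k b X).
{ intros k Ck.
  rewrite <- (RInt_Chasles (V := R_CompleteNormedModule) k (- X) b X) by auto.
  rewrite <- (RInt_Chasles (V := R_CompleteNormedModule) k (- X) a b) by auto. reflexivity. }
assert (B : forall (k : R -> R) u v, u <= v -> (forall x, continuous k x) ->
  (forall x, u < x < v -> Rabs (k x) <= M x) -> Rabs (RInt k u v) <= RInt M u v).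
{ intros k u v Huv Ck Hk. apply Rle_trans with (1 := abs_RInt_le k u v Huv (I _ _ _ Ck)).
  apply RInt_le; auto. apply I. intros x.
  apply (continuous_comp k Rabs); [apply Ck | apply continuous_Rabs]. }
rewrite (S g Cg), (S M CM).
assert (E : RInt (fun x => h x - g x) a b = RInt h a b - RInt g a b).
{ exact (RInt_minus (V := R_CompleteNormedModule) h g a b (I _ _ _ Ch) (I _ _ _ Cg)). }
assert (Bm : Rabs (RInt h a b - RInt g a b) <= RInt M a b).
{ rewrite <- E. apply B; [assumption | |intros; apply Hin; lra].
  intros x. apply (continuous_minus (V := R_NormedModule)); auto. }
assert (Bl := B g (- X) a H1 Cg ltac:(intros; apply Hout; lra)).
assert (Br := B g b X H3 Cg ltac:(intros; apply Hout; lra)).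
apply Rabs_le_between in Bm, Bl, Br. apply Rabs_le. lra.
Qed.

Lemma laplace_estimate (r lambda k : R) : 1 < r < 3 + 2 * sqrt 2 -> 0 < lambda ->
  512 * sqrt r ^ 3 <= lambda * ((r + 1) * sqrt (disc r) ^ 3) -> / 3 <= k ->
  (forall t, 0 <= t <= PI ->
    Rabs (integrand r lambda t - gaussian r lambda (t - theta0 r))
    <= majorant r lambda k (t - theta0 r)) ->
  Rabs (RInt (integrand r lambda) 0 PI
    - sqrt (PI / (lambda * (sqrt (disc r) / 4))) * cos (lambda * V r (theta0 r) + alpha r / 2))
  <= k / (lambda * kappa r ^ 2).
Proof.
intros Hr Hl HL Hk Hpt. destruct (disc_bounds r Hr) as [[H1 H2] H3].
destruct (sqrt_gt_1 r ltac:(lra)) as [Hs Hss].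
pose proof (sqrt_sqrt (disc r) ltac:(lra)) as Hd.
pose proof (sqrt_lt_R0 (disc r) ltac:(lra)) as Hd0.
destruct (theta0_spec r Hr) as (Ht & Hct & Hst).
destruct (alpha_spec r Hr) as (Ha & Hsa & Hca).
pose proof (kappa_le_pw r Hr) as Hkp.
set (A := lambda * (sqrt (disc r) / 4)).
assert (HA : 0 < A) by (unfold A; apply Rmult_lt_0_compat; lra).
destruct (rotated_gauss_limit A (alpha r) (lambda * V r (theta0 r)) HA Ha) as [K HK].
assert (EG : forall x, exp (- (A * cos (alpha r) * (x * x)))
    * cos (lambda * V r (theta0 r) + A * sin (alpha r) * (x * x)) = gaussian r lambda x).
{ intros x. unfold gaussian, A, pw, qw. rewrite Hsa, Hca.
  replace (lambda * (sqrt (disc r) / 4) * ((r + 1) * sqrt (disc r) / (4 * r)))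
    with (lambda * ((r + 1) * (sqrt (disc r) * sqrt (disc r)) / (16 * r))) by (field; lra).
  rewrite Hd.
  replace (lambda * (sqrt (disc r) / 4) * ((r - 1) ^ 2 / (4 * r)))
    with (lambda * (sqrt (disc r) * (r - 1) ^ 2 / (16 * r))) by (field; lra).
  reflexivity. }
(* The hypothesis on lambda makes the majorant dominate the Gaussian outside the contour. *)
assert (Hout : forall x, x <= - theta0 r \/ PI - theta0 r <= x ->
  Rabs (gaussian r lambda x) <= majorant r lambda k x).
{ intros x Hx. apply Rle_trans with (1 := gaussian_decay r lambda x Hr Hl).
  unfold majorant. rewrite <- (Rmult_1_l (exp _)) at 1.
  rewrite <- (Rmult_assoc (lambda * k) (Rabs x ^ 3)).
  apply Rmult_le_compat_r; [left; apply exp_pos|].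
  (* Both ends of [0, PI] are at distance at least [theta0] from the saddle, as
     [theta0 < PI / 2]. *)
  assert (Hsx : sin (theta0 r) <= Rabs x).
  { apply Rle_trans with (theta0 r); [left; apply sin_lt_x; lra|].
    destruct Hx; [rewrite Rabs_left by lra | rewrite Rabs_pos_eq by lra]; lra. }
  assert (Hs3 : sin (theta0 r) ^ 3 <= Rabs x ^ 3).
  { apply pow_incr. split; [|exact Hsx]. rewrite Hst. apply Rdiv_le_0_compat; lra. }
  assert (E3 : 8 * sqrt r ^ 3 * sin (theta0 r) ^ 3 = sqrt (disc r) ^ 3) by (rewrite Hst; field; lra).
  rewrite <- E3 in HL.
  assert (Hr3 : 0 < sqrt r ^ 3) by (apply pow_lt; lra).
  assert (H64 : 64 <= lambda * (r + 1) * sin (theta0 r) ^ 3).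
  { apply Rmult_le_reg_l with (8 * sqrt r ^ 3); lra. }
  assert (H64' : lambda * (r + 1) * sin (theta0 r) ^ 3 <= lambda * (r + 1) * Rabs x ^ 3)
    by (apply Rmult_le_compat_l; [nra | exact Hs3]).
  assert (0 <= lambda * Rabs x ^ 3).
  { apply Rmult_le_pos; [lra|]. apply pow_le, Rabs_pos. }
  (* Uses [r + 1 < 7]; with [k >= 1/3] it yields [lambda k |x|^3 >= 64/21 > 1]. *)
  assert (64 <= 7 * (lambda * Rabs x ^ 3)) by nra.
  nra. }
assert (EI : RInt (fun x => 1 * integrand r lambda (1 * x + theta0 r)) (- theta0 r) (PI - theta0 r)
  = RInt (integrand r lambda) 0 PI).
{ rewrite RInt_comp_affine by (intros; apply continuous_integrand; lra). f_equal; ring. }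
apply le_epsilon. intros eps Heps.
(* A finite window replaces the real line: [PI <= X] makes it contain the shifted contour, and the
   other bound leaves at most [eps] for the truncated Gaussian. *)
set (X := Rmax PI (Rabs K / eps)).
assert (HX1 : PI <= X) by apply Rmax_l.
assert (HX2 : Rabs K / eps <= X) by apply Rmax_r.
pose proof PI2_3_2.
assert (HKX : K / X <= eps).
{ apply Rmult_le_reg_r with X; [lra|]. replace (K / X * X) with K by (field; lra).
  apply Rle_trans with (1 := Rle_abs K).
  apply Rmult_le_compat_l with (r := eps) in HX2; [|lra].
  replace (eps * (Rabs K / eps)) with (Rabs K) in HX2 by (field; lra). exact HX2. }
specialize (HK X ltac:(lra)).
rewrite (RInt_ext_R _ (gaussian r lambda)) in HK by (intros; apply EG).
assert (HC := RInt_compare (fun x => 1 * integrand r lambda (1 * x + theta0 r))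
  (gaussian r lambda) (majorant r lambda k) (- theta0 r) (PI - theta0 r) X
  ltac:(lra) ltac:(lra) ltac:(lra)).
rewrite EI in HC.
assert (HC' : Rabs (RInt (integrand r lambda) 0 PI - RInt (gaussian r lambda) (- X) X)
  <= RInt (majorant r lambda k) (- X) X).
{ apply HC.
  - intros x. apply (continuous_scal_r (V := R_NormedModule) 1).
    apply (continuous_comp (fun y => 1 * y + theta0 r) (integrand r lambda));
      [ctn | apply continuous_integrand; lra].
  - intros x. unfold gaussian. ctn.
  - apply continuous_majorant.
  - intros x Hx. rewrite !Rmult_1_l.
    replace x with (x + theta0 r - theta0 r) at 2 3 by ring. apply Hpt. lra.
  - exact Hout. }
assert (HM : RInt (majorant r lambda k) (- X) X <= k / (lambda * kappa r ^ 2)).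
{ unfold majorant. rewrite RInt_scal_l.
  2:{ apply (ex_RInt_continuous (V := R_CompleteNormedModule)). intros z _.
      apply (continuous_mult (K := R_AbsRing)).
      - apply (continuous_comp Rabs (fun y => y ^ 3)); [apply continuous_Rabs | ctn].
      - ctn. }
  replace (k / (lambda * kappa r ^ 2)) with (lambda * k * / (lambda * kappa r * (lambda * kappa r)))
    by (field; lra).
  apply Rmult_le_compat_l; [nra|]. apply RInt_cubic_gauss; [apply Rmult_lt_0_compat; lra | lra]. }
apply Rabs_le_between in HC', HK. apply Rabs_le. lra.
Qed.

(** * Conjugation symmetry and final normalisation *)

Lemma UV_opp (r t : R) : 1 < r -> U r (- t) = U r t /\ V r (- t) = - V r t.
Proof.
intros Hr. destruct (UV_arg_pos r t Hr) as (_ & _ & H1 & H2 & _).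
unfold U, V. rewrite cos_neg, sin_neg. split; [reflexivity|].
replace (- sin t / (sqrt r + cos t)) with (- (sin t / (sqrt r + cos t))) by (field; lra).
replace (- sin t / (sqrt r - cos t)) with (- (sin t / (sqrt r - cos t))) by (field; lra).
rewrite !atan_opp. ring.
Qed.

(** [U] is even and [V] odd, so the imaginary part integrates to 0 and the real part doubles,
    turning [1 / (2 PI)] into [1 / PI]. The power of 2 is the value of [exp (lambda U)] at the
    saddle. *)
Lemma Iint_eq (r lambda : R) : 1 < r < 3 + 2 * sqrt 2 ->
  Iint r lambda = RtoC (/ PI * Rpower 2 ((r + 1) * lambda / 2) * RInt (integrand r lambda) 0 PI).
Proof.
intros Hr. pose proof PI_RGT_0 as Hpi.
set (c := Rpower 2 ((r + 1) * lambda / 2) / (2 * PI)).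
assert (Hexp : forall t, exp (lambda * U r t)
  = Rpower 2 ((r + 1) * lambda / 2) * exp (lambda * (U r t - U r (theta0 r)))).
{ intros t. unfold Rpower. rewrite <- exp_plus, U_saddle by exact Hr. f_equal. field. }
set (g := fun t => c * integrand r lambda t).
set (h := fun t => c * (exp (lambda * (U r t - U r (theta0 r))) * sin (lambda * V r t))).
assert (E : forall t, (Cexp (RtoC lambda * Defs.f r t) / RtoC (2 * PI))%C = (g t, h t)).
{ intros t. rewrite f_eq by lra. unfold Cexp, RtoC, Cdiv, Cinv, Cmult, Re, Im; cbn [fst snd].
  replace (lambda * U r t - 0 * V r t) with (lambda * U r t) by ring.
  replace (lambda * V r t + 0 * U r t) with (lambda * V r t) by ring.
  rewrite Hexp. unfold g, h, integrand, c.
  apply injective_projections; cbn [fst snd]; field; lra. }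
assert (Cg : forall t, continuous g t).
{ intros t. apply (continuous_scal_r (V := R_NormedModule) c). apply continuous_integrand. lra. }
assert (Ch : forall t, continuous h t).
{ intros t. apply (ex_derive_continuous (V := R_NormedModule)).
  pose proof (is_derive_U r t ltac:(lra)) as DU. pose proof (is_derive_V r t ltac:(lra)) as DV.
  unfold h. auto_derive. repeat split; eexists; eassumption. }
unfold Iint.
rewrite (RInt_ext (V := C_R_CompleteNormedModule) _ (fun t => (g t, h t)))
  by (intros; apply E).
apply (is_RInt_unique (V := C_R_CompleteNormedModule)).
unfold RtoC.
apply (is_RInt_fct_extend_pair (U := R_NormedModule) (V := R_NormedModule) (fun t => (g t, h t)));
  cbn [fst snd].
- assert (Hg : / PI * Rpower 2 ((r + 1) * lambda / 2) * RInt (integrand r lambda) 0 PI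
    = RInt g (- PI) PI).
  { rewrite RInt_symmetric by exact Cg.
    rewrite (RInt_ext_R (fun t => g (- t)) g).
    - unfold g. rewrite RInt_scal_l.
      + unfold c. field. lra.
      + apply (ex_RInt_continuous (V := R_CompleteNormedModule)).
        intros; apply continuous_integrand; lra.
    - intros t _. unfold g, integrand. destruct (UV_opp r t ltac:(lra)) as [-> ->].
      rewrite Ropp_mult_distr_r_reverse, cos_neg. reflexivity. }
  rewrite Hg. apply (RInt_correct (V := R_CompleteNormedModule)).
  apply (ex_RInt_continuous (V := R_CompleteNormedModule)). intros; apply Cg.
- assert (Hh : 0 = RInt h (- PI) PI).
  { rewrite RInt_symmetric by exact Ch.
    rewrite (RInt_ext_R (fun t => h (- t)) (fun t => -1 * h t)).
    - rewrite RInt_scal_l; [ring|].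
      apply (ex_RInt_continuous (V := R_CompleteNormedModule)). intros; apply Ch.
    - intros t _. unfold h. destruct (UV_opp r t ltac:(lra)) as [-> ->].
      rewrite Ropp_mult_distr_r_reverse, sin_neg. ring. }
  rewrite Hh. apply (RInt_correct (V := R_CompleteNormedModule)).
  apply (ex_RInt_continuous (V := R_CompleteNormedModule)). intros; apply Ch.
Qed.

Theorem theorem6 :
  forall r lambda : R,
    1 < r < 3 + 2 * sqrt 2 ->
    0 < lambda ->
    512 * Rpower r (3 / 2)
      / ((r + 1) * Rpower (- r ^ 2 + 6 * r - 1) (3 / 2)) <= lambda ->
    Cmod
      (RtoC (Rpower (- r ^ 2 + 6 * r - 1) (1 / 4) * sqrt (PI * lambda)
             / Rpower 2 (1 + (r + 1) * lambda / 2))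
         * Iint r lambda
       - RtoC (cos ((r * gamma1 r + gamma2 r) * lambda + gamma3 r)))%C
    <= 16336 / (sqrt lambda * Rpower (- r ^ 2 + 6 * r - 1) (11 / 4)).
Proof.
intros r lambda Hr Hl HL. fold (disc r) in *.
apply (lambda_saddle r lambda Hr) in HL.
destruct (pointwise_bound r lambda Hr Hl HL) as (k & Hk1 & Hk2 & Hpt).
pose proof (laplace_estimate r lambda k Hr Hl HL Hk1 Hpt) as HE.
destruct (disc_bounds r Hr) as [[H1 H2] H3].
pose proof (sqrt_lt_R0 (disc r) H1) as Hd0.
rewrite V_saddle in HE by exact Hr.
replace (gamma3 r) with (alpha r / 2) by (unfold gamma3, alpha; field).
rewrite (Rmult_comm (r * gamma1 r + gamma2 r) lambda), Iint_eq by exact Hr.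
set (J := RInt (integrand r lambda) 0 PI) in *.
set (cs := cos _) in *.
set (q := Rpower (disc r) (1 / 4)).
assert (Hq0 : 0 < q) by apply exp_pos.
assert (Hq2 : sqrt (disc r) = q * q).
{ unfold q. rewrite <- Rpower_plus, <- Rpower_sqrt by lra. f_equal. field. }
assert (Hq11 : Rpower (disc r) (11 / 4) = disc r ^ 3 / q).
{ unfold q, Rdiv. rewrite <- Rpower_Ropp, <- Rpower_pow, <- Rpower_plus by lra.
  f_equal. simpl. field. }
pose proof PI_RGT_0 as Hpi. pose proof sqrt_PI_bounds as HpiB.
pose proof (sqrt_sqrt PI ltac:(lra)) as HpiS.
pose proof (sqrt_sqrt lambda ltac:(lra)) as HlS.
pose proof (sqrt_lt_R0 lambda Hl) as Hl0.
set (sl := sqrt lambda) in *. set (sp := sqrt PI) in *.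
assert (HP : 0 < Rpower 2 ((r + 1) * lambda / 2)) by apply exp_pos.
rewrite Rpower_plus, Rpower_1, sqrt_mult by lra. fold sl sp.
rewrite <- RtoC_mult, <- RtoC_minus, Cmod_R.
(* The Gaussian amplitude is the inverse of the factor [q sl / (2 sp)] left by the normalisation, so
   the main term is exactly the cosine. *)
assert (Hsq : sqrt (PI / (lambda * (sqrt (disc r) / 4))) = 2 * sp / (sl * q)).
{ apply sqrt_sq_eq; [apply Rdiv_le_0_compat; nra|].
  rewrite Hq2, <- HpiS, <- HlS. field. split; lra. }
rewrite Hsq in HE.
replace (q * (sp * sl) / (2 * Rpower 2 ((r + 1) * lambda / 2))
    * (/ PI * Rpower 2 ((r + 1) * lambda / 2) * J) - cs)
  with (q * sl / (2 * sp) * (J - 2 * sp / (sl * q) * cs)).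
2:{ rewrite <- HpiS. field. repeat split; lra. }
rewrite Rabs_mult, Rabs_pos_eq by (apply Rdiv_le_0_compat; nra).
apply Rle_trans with (q * sl / (2 * sp) * (k / (lambda * kappa r ^ 2))).
{ apply Rmult_le_compat_l; [apply Rdiv_le_0_compat; nra | exact HE]. }
rewrite Hq11. unfold kappa.
replace (q * sl / (2 * sp) * (k / (lambda * (disc r / (16 * (r + 1))) ^ 2)))
  with (128 * (k * ((r + 1) ^ 2 * disc r)) / sp * (q / (sl * disc r ^ 3))).
2:{ rewrite <- HlS. field. repeat split; lra. }
replace (16336 / (sl * (disc r ^ 3 / q))) with (16336 * (q / (sl * disc r ^ 3))) by (field; lra).
apply Rmult_le_compat_r.
- apply Rdiv_le_0_compat; [lra|]. apply Rmult_lt_0_compat; [lra | apply pow_lt; lra].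
(* What remains is [128 * 220 = 28160 <= 16336 * 1.73], with [sqrt PI >= 1.73]. *)
- apply Rmult_le_reg_r with sp; [lra|].
  replace (128 * (k * ((r + 1) ^ 2 * disc r)) / sp * sp)
    with (128 * (k * ((r + 1) ^ 2 * disc r))) by (field; lra).
  lra.
Qed.
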